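(* Let $D\subseteq\mathbb{R}_\mathbb{C}$ be an open set invariant under conjugation. Let $\check f\in\mathcal{DS}(\check{\Omega}_D)$ be the natural extension to $\check{\Omega}_D$ of $f=g+\epsilon h$ with $g\in\mathcal{S}^1_\mathbb{H}(\Omega_D)$, $h\in\mathcal{S}^0_\mathbb{H}(\Omega_D)$. If $x=x_1+\epsilon x_2\in\check{\Omega}_D$ with $x_1\in\mathbb{H}\setminus\mathbb{R}$ and $x_2\in\mathbb{H}$, then $$\check f(x)=f(x_1)+\epsilon\, d({}^\pi\! f)_{x_1}(x_2).$$ If $f\in\mathcal{S}^{3,0}(\Omega_D)$, then this formula holds true for all $x=x_1+\epsilon x_2\in\check{\Omega}_D$. The condition $f\in\mathcal{S}^{3,0}(\Omega_D)$ is automatically true if $\check f\in\mathcal{DS}^2(\check{\Omega}_D)$ and, in particular, when $\check f\in\mathcal{DSR}(\check{\Omega}_D)$.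
   Context: Algebra. $\mathbb{H}$ is the algebra of quaternions with conjugation $x\mapsto x^c$. $\mathbb{DH}=\mathbb{H}+\epsilon\mathbb{H}$ is the algebra of dual quaternions $x=x_1+\epsilon x_2$ ($x_1,x_2\in\mathbb{H}$; subscripts $1,2$ denote these components), with $\epsilon$ central and $\epsilon^2=0$, and $(x_1+\epsilon x_2)^c=x_1^c+\epsilon x_2^c$. $\mathbb{DR}=\mathbb{R}+\epsilon\mathbb{R}$. $\mathbb{S}_\mathbb{H}=\{J\in\mathbb{H}:J^2=-1\}$ and $\mathbb{S}_\mathbb{DH}=\{J\in\mathbb{DH}: J+J^c=0,\ JJ^c=1\}=\{J_1+\epsilon J_2: J_1\in\mathbb{S}_\mathbb{H}, J_2\in\operatorname{Im}(\mathbb{H}), J_1\perp J_2\}$. For $A\in\{\mathbb{R},\mathbb{DR},\mathbb{H},\mathbb{DH}\}$, $A_\mathbb{C}=A\otimes_\mathbb{R}\mathbb{C}=\{a+e_1b:a,b\in A\}$, with $e_1$ central, $e_1^2=-1$, and $\overline{a+e_1b}=a-e_1b$. Thus $\mathbb{R}_\mathbb{C}\cong\mathbb{C}$. Slice functions. Set $\Omega_D=\{\alpha+J\beta:\alpha,\beta\in\mathbb{R},\ \alpha+e_1\beta\in D,\ J\in\mathbb{S}_\mathbb{DH}\}\subset\mathbb{DH}$. A stem function is $F=F_0+e_1F_1:D\to\mathbb{DH}_\mathbb{C}$ ($F_0,F_1$ $\mathbb{DH}$-valued) with $F(\bar z)=\overline{F(z)}$. It induces the slice function $f=\mathcal{I}(F):\Omega_D\to\mathbb{DH}$,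 $f(\alpha+J\beta)=F_0(\alpha+e_1\beta)+JF_1(\alpha+e_1\beta)$; $F$ is uniquely determined by $f$. $\mathcal{S}^k_\mathbb{H}(\Omega_D)$ is the set of slice functions induced by $\mathbb{H}_\mathbb{C}$-valued stem functions of class $C^k$, and $\mathcal{S}^{h,k}(\Omega_D)=\mathcal{S}^h_\mathbb{H}(\Omega_D)+\epsilon\,\mathcal{S}^k_\mathbb{H}(\Omega_D)$ (direct sum). $\mathcal{SR}(\Omega_D)$ (slice regular functions) is the set of slice functions induced by stem functions $F$ of class $C^1$ with $\frac{\partial F}{\partial\alpha}+e_1\frac{\partial F}{\partial\beta}=0$. The primal part of a slice function $f:\Omega_D\to\mathbb{DH}$ is the quaternionic function ${}^\pi\! f:\Omega_D\cap\mathbb{H}\to\mathbb{H}$ mapping $x_1$ to the $\mathbb{H}$-component of $f(x_1)$; for $f=g+\epsilon h$ with $g\in\mathcal{S}^1_\mathbb{H}(\Omega_D)$, $h\in\mathcal{S}^0_\mathbb{H}(\Omega_D)$ it is $g|_{\Omega_D\cap\mathbb{H}}$. Here $\Omega_D\cap\mathbb{H}$ is an open subset of $\mathbb{H}\cong\mathbb{R}^4$, and $d({}^\pi\! f)_{x_1}:\mathbb{H}\to\mathbb{H}$ is the real differential at $x_1$. Natural extension. Let $\check D=D+\epsilon\mathbb{R}_\mathbb{C}\subset\mathbb{DR}_\mathbb{C}$ and $\check{\Omega}_D=\Omega_D+\epsilon\mathbb{H}=\{a+Ib: a,b\in\mathbb{DR},\ a+e_1b\in\check D,\ I\in\mathbb{S}_\mathbb{DH}\}$.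 Let $f=\mathcal{I}(F)\in\mathcal{S}^{1,0}(\Omega_D)$, with $F=G+\epsilon H$, $G=G_0+e_1G_1$ of class $C^1$ and $H=H_0+e_1H_1$ of class $C^0$, both $\mathbb{H}_\mathbb{C}$-valued stem functions. For $\ell=0,1$, $a=a_1+\epsilon a_2$ and $b=b_1+\epsilon b_2$ in $\mathbb{DR}$, set $$\check F_\ell(a+e_1b)=G_\ell(z_1)+\epsilon\Big(H_\ell(z_1)+a_2\tfrac{\partial G_\ell}{\partial\alpha}(z_1)+b_2\tfrac{\partial G_\ell}{\partial\beta}(z_1)\Big),\quad z_1=a_1+e_1b_1\in D.$$ The natural extension of $f$ is the (well-defined) function $\check f:\check{\Omega}_D\to\mathbb{DH}$, $\check f(a+Ib)=\check F_0(a+e_1b)+I\check F_1(a+e_1b)$. $\mathcal{DS}(\check{\Omega}_D)$ is the set of all such $\check f$ with $f\in\mathcal{S}^{1,0}(\Omega_D)$; $\mathcal{DS}^k(\check{\Omega}_D)=\{\check f:f\in\mathcal{S}^{k+1,k}(\Omega_D)\}$; $\mathcal{DSR}(\check{\Omega}_D)=\{\check f:f\in\mathcal{SR}(\Omega_D)\}$. *)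

(* Defs.v *)
From HB Require Import structures.
From mathcomp Require Import all_boot all_order all_algebra.
From mathcomp Require Import ring.
From mathcomp Require Import all_classical all_reals all_analysis.

Set Implicit Arguments.
Unset Strict Implicit.
Unset Printing Implicit Defensive.

Import Order.TTheory GRing.Theory Num.Theory.
Import numFieldNormedType.Exports.

Local Open Scope classical_set_scope.
Local Open Scope ring_scope.

(* (a, b, c, d) stands for a + b i + c j + d k.  As a normed space (the norm is
   the sup norm, equivalent to the Euclidean one) it is R x R x R x R, but the
   type is an alias so that its product is Hamilton's and not componentwise. *)
Definition quat (R : realType) : Type := (R * R * R * R)%type.
HB.instance Definition _ (R : realType) :=
  NormedModule.copy (quat R) (R * R * R * R)%type.

Definition mulq (R : realType) (x y : quat R) : quat R :=
  let: (a, b, c, d) := x in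
  let: (a', b', c', d') := y in
  (a * a' - b * b' - c * c' - d * d',
   a * b' + b * a' + c * d' - d * c',
   a * c' - b * d' + c * a' + d * b',
   a * d' + b * c' - c * b' + d * a').

Definition oneq (R : realType) : quat R := (1, 0, 0, 0).

Definition conjq (R : realType) (x : quat R) : quat R :=
  let: (a, b, c, d) := x in (a, - b, - c, - d).

Lemma mulqA (R : realType) : associative (@mulq R).
Proof.
move=> [[[a b] c] d] [[[a' b'] c'] d'] [[[a'' b''] c''] d''] /=.
by congr (_, _, _, _); ring.
Qed.

Lemma mul1q (R : realType) : left_id (oneq R) (@mulq R).
Proof. by move=> [[[a b] c] d] /=; congr (_, _, _, _); ring. Qed.

Lemma mulq1 (R : realType) : right_id (oneq R) (@mulq R).
Proof. by move=> [[[a b] c] d] /=; congr (_, _, _, _); ring. Qed.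

Lemma mulqDl (R : realType) : left_distributive (@mulq R) +%R.
Proof.
move=> [[[a b] c] d] [[[a' b'] c'] d'] [[[a'' b''] c''] d''].
by congr (_, _, _, _); rewrite /=; ring.
Qed.

Lemma mulqDr (R : realType) : right_distributive (@mulq R) +%R.
Proof.
move=> [[[a b] c] d] [[[a' b'] c'] d'] [[[a'' b''] c''] d''].
by congr (_, _, _, _); rewrite /=; ring.
Qed.

Lemma oneq_neq0 (R : realType) : oneq R != 0.
Proof. by apply/eqP => -[]; apply/eqP; rewrite oner_eq0. Qed.

HB.instance Definition _ (R : realType) :=
  GRing.Zmodule_isNzRing.Build (quat R)
    (@mulqA R) (@mul1q R) (@mulq1 R) (@mulqDl R) (@mulqDr R) (@oneq_neq0 R).

Lemma scaleqAl (R : realType) (r : R) (x y : quat R) :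
  r *: mulq x y = mulq (r *: x) y.
Proof.
case: x y => [[[a b] c] d] [[[a' b'] c'] d'].
by congr (_, _, _, _); rewrite /= /GRing.scale /=; ring.
Qed.

Lemma scaleqAr (R : realType) (r : R) (x y : quat R) :
  r *: mulq x y = mulq x (r *: y).
Proof.
case: x y => [[[a b] c] d] [[[a' b'] c'] d'].
by congr (_, _, _, _); rewrite /= /GRing.scale /=; ring.
Qed.

HB.instance Definition _ (R : realType) :=
  GRing.Lmodule_isLalgebra.Build R (quat R) (@scaleqAl R).
HB.instance Definition _ (R : realType) :=
  GRing.Lalgebra_isAlgebra.Build R (quat R) (@scaleqAr R).

(* (x1, x2) stands for x1 + eps x2. *)
Definition dquat (R : realType) : Type := (quat R * quat R)%type.
HB.instance Definition _ (R : realType) :=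
  NormedModule.copy (dquat R) (quat R * quat R)%type.

Definition muldq (R : realType) (x y : dquat R) : dquat R :=
  (x.1 * y.1, x.1 * y.2 + x.2 * y.1).

Definition onedq (R : realType) : dquat R := (1, 0).

Definition conjdq (R : realType) (x : dquat R) : dquat R :=
  (conjq x.1, conjq x.2).

Lemma muldqA (R : realType) : associative (@muldq R).
Proof.
move=> [x1 x2] [y1 y2] [z1 z2]; rewrite /muldq /=.
by rewrite !mulrDl !mulrDr !mulrA addrA.
Qed.

Lemma mul1dq (R : realType) : left_id (onedq R) (@muldq R).
Proof. by move=> [x1 x2]; rewrite /muldq /= !mul1r mul0r addr0. Qed.

Lemma muldq1 (R : realType) : right_id (onedq R) (@muldq R).
Proof. by move=> [x1 x2]; rewrite /muldq /= !mulr1 mulr0 add0r. Qed.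

Lemma muldqDl (R : realType) : left_distributive (@muldq R) +%R.
Proof.
move=> [x1 x2] [y1 y2] [z1 z2]; congr (_, _); rewrite /= !mulrDl //.
by rewrite addrACA.
Qed.

Lemma muldqDr (R : realType) : right_distributive (@muldq R) +%R.
Proof.
move=> [x1 x2] [y1 y2] [z1 z2]; congr (_, _); rewrite /= !mulrDr //.
by rewrite addrACA.
Qed.

Lemma onedq_neq0 (R : realType) : onedq R != 0.
Proof. by apply/eqP => -[]; apply/eqP; rewrite oner_eq0. Qed.

HB.instance Definition _ (R : realType) :=
  GRing.Zmodule_isNzRing.Build (dquat R)
    (@muldqA R) (@mul1dq R) (@muldq1 R) (@muldqDl R) (@muldqDr R)
    (@onedq_neq0 R).

Lemma scaledqAl (R : realType) (r : R) (x y : dquat R) :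
  r *: muldq x y = muldq (r *: x) y.
Proof.
congr (_, _); first exact: scalerAl.
by rewrite [LHS]scalerDr !scalerAl.
Qed.

Lemma scaledqAr (R : realType) (r : R) (x y : dquat R) :
  r *: muldq x y = muldq x (r *: y).
Proof.
congr (_, _); first exact: scalerAr.
by rewrite [LHS]scalerDr !scalerAr.
Qed.

HB.instance Definition _ (R : realType) :=
  GRing.Lmodule_isLalgebra.Build R (dquat R) (@scaledqAl R).
HB.instance Definition _ (R : realType) :=
  GRing.Lalgebra_isAlgebra.Build R (dquat R) (@scaledqAr R).

Definition eps (R : realType) : dquat R := (0, 1).

Definition dquat_of_quat (R : realType) (x : quat R) : dquat R := (x, 0).

(* Dual reals a1 + eps a2 are represented by pairs (a1, a2). *)
Definition dquat_of_dual (R : realType) (a : R * R) : dquat R :=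
  a.1%:A + a.2 *: eps R.

Definition sphere_dq (R : realType) : set (dquat R) :=
  [set J | J + conjdq J = 0 /\ J * conjdq J = 1].

Definition real_quat (R : realType) : set (quat R) :=
  [set x | exists r : R, x = r%:A].

(* An element a + e1 b of the complexification of A is the pair (a, b). *)
Definition conjc (A : zmodType) (w : A * A) : A * A := (w.1, - w.2).
Definition mul_e1 (A : zmodType) (w : A * A) : A * A := (- w.2, w.1).

Definition conj_invariant (R : realType) (D : set (R * R)) : Prop :=
  forall z, D z -> D (conjc z).

Section slice.
Variable R : realType.
Implicit Types (D : set (R * R)) (f fc : dquat R -> dquat R) (k : nat).

Definition partial_alpha (V : normedModType R) (F : R * R -> V) : R * R -> V :=
  'D_((1, 0) : R * R) F.
Definition partial_beta (V : normedModType R) (F : R * R -> V) : R * R -> V :=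
  'D_((0, 1) : R * R) F.

(* Class C^k on an open set D: all partial derivatives of order at most k exist
   and are continuous at the points of D. *)
Fixpoint class_C (V : normedModType R) k D (F : R * R -> V) : Prop :=
  (forall z, D z -> {for z, continuous F}) /\
  if k is k'.+1 then
    [/\ forall z, D z -> derivable F z ((1, 0) : R * R) /\
                         derivable F z ((0, 1) : R * R),
        class_C k' D (partial_alpha F) & class_C k' D (partial_beta F)]
  else True.

(* In the following, functions on D, on Omega D, or on the natural extension of
   Omega D are represented by total functions whose values outside of the
   domain are irrelevant. *)

Definition stem (A : zmodType) D (F : R * R -> A * A) : Prop :=
  forall z, D z -> F (conjc z) = conjc (F z).

Definition Omega D : set (dquat R) :=
  [set x | exists al be J, [/\ D (al, be), sphere_dq J & x = al%:A + be *: J]].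

Definition induces D (F : R * R -> dquat R * dquat R) f : Prop :=
  forall al be J, D (al, be) -> sphere_dq J ->
    f (al%:A + be *: J) = (F (al, be)).1 + J * (F (al, be)).2.

Definition stem_of_quat (G : R * R -> quat R * quat R)
    (z : R * R) : dquat R * dquat R :=
  (dquat_of_quat (G z).1, dquat_of_quat (G z).2).

Definition slice_H k D : set (dquat R -> dquat R) :=
  [set f | exists G : R * R -> quat R * quat R,
    [/\ stem D G, class_C k D G & induces D (stem_of_quat G) f]].

Definition slice_DH h k D : set (dquat R -> dquat R) :=
  [set f | exists f1 f2, [/\ slice_H h D f1, slice_H k D f2 &
    forall x, Omega D x -> f x = f1 x + eps R * f2 x]].

Definition slice_regular D : set (dquat R -> dquat R) :=
  [set f | exists F : R * R -> dquat R * dquat R,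
    [/\ stem D F, class_C 1 D F,
        forall z, D z -> partial_alpha F z + mul_e1 (partial_beta F z) = 0 &
        induces D F f]].

Definition primal_part f (x : quat R) : quat R := (f (dquat_of_quat x)).1.

Definition check_Omega D : set (dquat R) :=
  [set x | exists a b I, [/\ D (a.1, b.1), sphere_dq I &
    x = dquat_of_dual a + I * dquat_of_dual b]].

(* The components of the stem function of the natural extension; here Gl and
   Hl are the l-th components of G and H, for l = 0, 1. *)
Definition check_stem (Gl Hl : R * R -> quat R) (a b : R * R) : dquat R :=
  let z1 := (a.1, b.1) in
  dquat_of_quat (Gl z1) +
  eps R * dquat_of_quat
    (Hl z1 + a.2 *: partial_alpha Gl z1 + b.2 *: partial_beta Gl z1).

(* The value of fc at x does not depend on the choice of a, b, I such that
   x = a + I b. *)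
Definition natural_extension D f fc : Prop :=
  exists G H : R * R -> quat R * quat R,
    [/\ stem D G /\ class_C 1 D G, stem D H /\ class_C 0 D H,
        induces D (fun z => ((stem_of_quat G z).1 + eps R * (stem_of_quat H z).1,
                             (stem_of_quat G z).2 + eps R * (stem_of_quat H z).2))
          f &
        forall a b I, D (a.1, b.1) -> sphere_dq I ->
          fc (dquat_of_dual a + I * dquat_of_dual b) =
          check_stem (fst \o G) (fst \o H) a b +
          I * check_stem (snd \o G) (snd \o H) a b].

Definition DSk k D : set (dquat R -> dquat R) :=
  [set fc | exists2 f, slice_DH k.+1 k D f & natural_extension D f fc].

Definition DSR D : set (dquat R -> dquat R) :=
  [set fc | exists2 f, slice_regular D f & natural_extension D f fc].

End slice.

(* Main.v *)
Require Import Defs.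
From HB Require Import structures.
From mathcomp Require Import all_boot all_order all_algebra.
From mathcomp Require Import ring lra.
From mathcomp Require Import all_classical all_reals all_analysis.

(** Write a point of the extended domain as x1 + eps x2 = a + I b with dual
    reals a = a1 + eps a2, b = b1 + eps b2 and I = J + eps K.  Then
    x1 = a1 + b1 J and x2 = a2 + b2 J + b1 K, where K is imaginary and
    orthogonal to J: the three terms of x2 move the real part of x1, its
    distance to the real axis, and its imaginary unit.  The primal part of f is
    G0 + J G1 in these coordinates, so along x2 its differential should be

      a2 (dG0/dalpha + J dG1/dalpha) + b2 (dG0/dbeta + J dG1/dbeta) + K G1,

    and this is exactly what the eps component of the natural extension adds to
    f(x1).  The formula for the differential is primal_differential.

    Off the real axis it is the chain rule: the real part, the signed length
    s of the imaginary part and the unit s^-1 Im are differentiable functions of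
    the point.  These coordinates degenerate at a real point, where parity takes
    over: since G0 is even and G1 is odd in beta, dG0/dbeta, G1 and dG1/dalpha
    vanish there, so that in the first order expansions of G0 and G1 the only
    term multiplied by the unit J is beta dG1/dbeta, and beta J = Im is linear.

    The remaining claims compare stem functions.  Taking a2 = b2 = 0 shows that
    the natural extension restricts to f, so it determines f on Omega D; and a
    slice function determines its stem on D, by evaluation at J and - J.  Hence
    it only remains to see that a stem of class C^1 that satisfies the
    Cauchy-Riemann equations is of class C^3.  Componentwise this concerns a
    pair of real functions u, v with u_alpha = v_beta and u_beta = - v_alpha.
    Consider, over the circle of radius r about z,

      m(r) = int (u cos t + v sin t) dt,     M(r) = int u_alpha dt.

    Differentiation under the integral gives m' = M, integrating
    d/dt (u sin t - v cos t) over a period gives m = r M, and so M' = 0 and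
    m(r) = 2 pi r u_alpha(z) (circle_flux_holomorphic).  This expresses
    u_alpha by an integral of u and v, which can be differentiated in z because
    u and v are of class C^1: the pair (u_alpha, v_alpha) is again of class C^1
    and satisfies the Cauchy-Riemann equations, and induction finishes. *)

Set Implicit Arguments.
Unset Strict Implicit.
Unset Printing Implicit Defensive.

Import Order.TTheory GRing.Theory Num.Theory.
Import numFieldNormedType.Exports.

Local Open Scope classical_set_scope.
Local Open Scope ring_scope.


(** * Differential calculus and functions of class C^k *)

(** Landau notation for the remainder is traded for an explicit estimate, which is
    how differentiability is checked where no composition rule applies. *)
Lemma is_diff_of_bound (R : realType) (V W : normedModType R) (f L : V -> W)
    (x : V) :
  linear L -> continuous L ->
  (forall e, 0 < e ->
     \forall w \near (0 : V), `|f (x + w) - f x - L w| <= e * `|w|) ->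
  is_diff x f L.
Proof.
move=> lL cL fL.
pose LM := GRing.isLinear.Build _ _ _ _ _ lL.
pose LL : {linear V -> W} := HB.pack L LM.
have LLE : LL = L :> (V -> W) by [].
have E : f \o shift x = cst (f x) + LL +o_ (0 : V) id.
  apply/eqaddoP => e e0; rewrite LLE.
  have := fL _ e0; apply: filter_app; near=> w.
  rewrite /= !fctE /= opprD [in X in _ -> X]addrA (addrC w x).
  exact.
have dE := @diff_unique _ _ _ f LL x cL E.
apply: DiffDef; last exact: dE.
by apply/diff_locallyP; rewrite dE LLE; split => //; rewrite {1}E.
Unshelve. all: by end_near. Qed.

Lemma is_diff_near_bound (R : realType) (V W : normedModType R) (f L : V -> W) (x : V) :
  is_diff x f L -> forall e, 0 < e ->
  \forall w \near (0 : V), `|f (x + w) - f x - L w| <= e * `|w|.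
Proof.
move=> [df <-] e e0; have /eqaddoP H := diff_locally df.
apply: filterS (H _ e0) => w.
by rewrite !fctE /= opprD [in X in X -> _]addrA (addrC w x).
Qed.

(** Differentiability is local; the explicit estimate makes this a statement about
    remainders that agree near 0. *)
Lemma near_eq_is_diff (R : realType) (V W : normedModType R) (f g L : V -> W) (x : V) :
  {near x, f =1 g} -> is_diff x f L -> is_diff x g L.
Proof.
move=> fg Df; have [df dE] := Df.
apply: is_diff_of_bound.
- by move=> k a b; rewrite -dE linearP.
- by rewrite -dE; exact: diff_continuous.
- move=> e e0.
  have c : {for (0 : V), continuous (fun w => x + w)}.
    by apply: cvgD; [exact: cvg_cst|exact: cvg_id].
  have n : \forall w \near (0 : V), f (x + w) = g (x + w).
    have fg0 : nbhs (x + 0) (fun y => f y = g y) by rewrite addr0.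
    exact: (c _ fg0).
  apply: filterS2 n (is_diff_near_bound Df e0) => w <-.
  by rewrite (nbhs_singleton fg).
Qed.

Lemma is_diff_linear (R : realType) (V W : normedModType R) (L : V -> W) (x : V) :
  linear L -> continuous L -> is_diff x L L.
Proof.
move=> lL cL; apply: is_diff_of_bound => // e e0.
apply: nearW => w; have := lL 1 x w; rewrite !scale1r => ->.
by rewrite (addrC (L x)) addrK subrr normr0 mulr_ge0// ltW.
Qed.

Lemma is_diff_sqrt (R : realType) (r : R) : 0 < r ->
  is_diff r (@Num.sqrt R) (fun h : R => h * (2 * Num.sqrt r)^-1).
Proof.
move=> r0; have [d dE] := is_derive1_sqrt r0.
apply: DiffDef; first exact/derivable1_diffP.
by rewrite deriv1E// derive1E dE.
Qed.

Lemma is_diff_inv (R : realType) (r : R) : r != 0 ->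
  is_diff r (@GRing.inv R) (fun h : R => - r ^- 2 * h).
Proof.
by move=> r0; apply: DiffDef; [exact: differentiable_Rinv|exact: diff_Rinv].
Qed.

Lemma is_derive_comp_diff (R : realType) (V W : normedModType R) (g : R -> V)
    (f : V -> W) (t : R) (dg : V) :
  is_derive t 1 g dg -> differentiable f (g t) ->
  is_derive t 1 (fun s => f (g s)) ('d f (g t) dg).
Proof.
move=> [/derivable1_diffP g1 g2] df.
have dfg : differentiable (fun s => f (g s)) t := differentiable_comp g1 df.
apply: DeriveDef; first exact/derivable1_diffP.
by rewrite deriveE// (diff_comp g1 df) /= -g2 deriveE.
Qed.

(** Reduces directional derivatives to derivatives of functions of one real
    variable, to which the mean value theorem applies. *)
Lemma is_derive_line (R : realType) (V W : normedModType R) (f : V -> W)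
    (x v : V) (t : R) (df : W) :
  is_derive (x + t *: v) v f df -> is_derive t 1 (fun s : R => f (x + s *: v)) df.
Proof.
have E : (fun h : R => h^-1 *: (((fun s : R => f (x + s *: v)) \o shift t) (h *: 1)
                               - f (x + t *: v))) =
         (fun h : R => h^-1 *: ((f \o shift (x + t *: v)) (h *: v)
                               - f (x + t *: v))).
  apply/funext => h /=; congr (_ *: (f _ - _)).
  by rewrite [h *: 1]mulr1 scalerDl addrCA.
move=> [d1 d2]; apply: DeriveDef; first by rewrite /derivable E.
by rewrite /derive E.
Qed.

Lemma is_derive_translate (R : realType) (V W : normedModType R) (f : V -> W)
    (x c v : V) (df : W) :
  is_derive (x + c) v f df -> is_derive x v (fun y => f (y + c)) df.
Proof.
have E : (fun h : R => h^-1 *: (((fun y => f (y + c)) \o shift x) (h *: v)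
                               - f (x + c))) =
         (fun h : R => h^-1 *: ((f \o shift (x + c)) (h *: v) - f (x + c))).
  by apply/funext => h /=; rewrite addrA.
move=> [d1 d2]; apply: DeriveDef; first by rewrite /derivable E.
by rewrite /derive E.
Qed.

Lemma is_derive_linear (R : realType) (V W X : normedModType R) (f : V -> W)
    (L : {linear W -> X}) (x v : V) (df : W) :
  continuous L -> is_derive x v f df -> is_derive x v (L \o f) (L df).
Proof.
move=> cL [d1 d2].
have E : (fun h : R => h^-1 *: (((L \o f) \o shift x) (h *: v) - (L \o f) x)) =
         L \o (fun h : R => h^-1 *: ((f \o shift x) (h *: v) - f x)).
  by apply/funext => h /=; rewrite linearZ (linearB L).
have C : (fun h : R => h^-1 *: (((L \o f) \o shift x) (h *: v) - (L \o f) x)) @ 0^'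
          --> L df.
  rewrite E -d2.
  have {}d1 : (fun h : R => h^-1 *: ((f \o shift x) (h *: v) - f x)) @ 0^' -->
              'D_v f x by exact: d1.
  exact: (cvg_comp _ _ d1 (cL _)).
by apply: DeriveDef; [apply/cvg_ex; exists (L df)|exact: cvg_lim].
Qed.

Lemma is_derive_pair (R : realType) (V W X : normedModType R) (f : V -> W)
    (g : V -> X) (x v : V) (df : W) (dg : X) :
  is_derive x v f df -> is_derive x v g dg ->
  is_derive x v (fun z => (f z, g z)) (df, dg).
Proof.
move=> [f1 f2] [g1 g2].
set q := fun z => (f z, g z).
have C : (fun h : R => h^-1 *: ((q \o shift x) (h *: v) - q x)) @ 0^' --> (df, dg).
  rewrite -f2 -g2.
  exact: (cvg_pair f1 g1).
by apply: DeriveDef; [apply/cvg_ex; exists (df, dg)|exact: cvg_lim].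
Qed.

(** The mean value theorem between 0 and c for c of either sign, with the one
    conclusion on the intermediate point that estimates use. *)
Lemma MVT_signed (R : realType) (g dg : R -> R) (c : R) :
  (forall a : R, `|a| <= `|c| -> is_derive a 1 g (dg a)) ->
  exists2 a, `|a| <= `|c| & g c - g 0 = dg a * c.
Proof.
move=> dgP.
have [c0|c0|->] := ltgtP c 0; last first.
- by exists 0; rewrite ?subrr ?mulr0.
- have [||a ac ->] := @MVT _ g dg 0 c c0.
  + move=> a; rewrite in_itv /= => /andP[a0 ac]; apply: dgP.
    by rewrite !gtr0_norm// ltW.
  + apply: derivable_within_continuous => a; rewrite in_itv /= => /andP[a0 ac].
    by have [] : is_derive a 1 g (dg a) by apply: dgP; rewrite !ger0_norm// ltW.
  + exists a; last by rewrite subr0.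
    by move: ac; rewrite in_itv /= => /andP[a0 ac]; rewrite !gtr0_norm// ltW.
- have [||a ac E] := @MVT _ g dg c 0 c0.
  + move=> a; rewrite in_itv /= => /andP[a0 ac]; apply: dgP.
    by rewrite !ltr0_norm// lerN2 ltW.
  + apply: derivable_within_continuous => a; rewrite in_itv /= => /andP[a0 ac].
    by have [] : is_derive a 1 g (dg a) by apply: dgP; rewrite !ler0_norm ?lerN2// ltW.
  + exists a; last by rewrite -opprB E sub0r mulrN opprK.
    by move: ac; rewrite in_itv /= => /andP[a0 ac]; rewrite !ltr0_norm// lerN2 ltW.
Qed.

Lemma near_eq_continuous (T U : topologicalType) (f g : T -> U) (x : T) :
  {near x, f =1 g} -> {for x, continuous f} -> {for x, continuous g}.
Proof.
move=> fg cf; apply: cvg_trans (near_eq_cvg fg) _.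
by rewrite -(nbhs_singleton fg); exact: cf.
Qed.

Section class_C.
Variables (R : realType) (D : set (R * R)).
Hypothesis Dopen : open D.

Lemma near_open (z : R * R) (P : R * R -> Prop) :
  D z -> (forall y, D y -> P y) -> \forall y \near z, P y.
Proof.
by move=> Dz DP; apply: filterS (open_nbhs_nbhs (conj Dopen Dz)).
Qed.

Lemma class_C_continuous (V : normedModType R) k (F : R * R -> V) z :
  class_C k D F -> D z -> {for z, continuous F}.
Proof. by case: k => [|k] [cF _]; exact: cF. Qed.

Lemma class_CW (V : normedModType R) k (F : R * R -> V) :
  class_C k.+1 D F -> class_C k D F.
Proof.
elim: k F => [|k IH] F [cF [dF aF bF]]; first by split.
split; first exact: cF.
by split; [exact: dF|exact: (IH _ aF)|exact: (IH _ bF)].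
Qed.

Lemma class_C_le (V : normedModType R) j k (F : R * R -> V) :
  (j <= k)%N -> class_C k D F -> class_C j D F.
Proof.
by move=> /subnK <-; elim: (k - j)%N => // n IH /class_CW.
Qed.

(** Class C^k on an open set sees only the values there, because a partial
    derivative at a point of D is determined by the values near that point. *)
Lemma class_C_ext (V : normedModType R) k (F F' : R * R -> V) :
  (forall z, D z -> F z = F' z) -> class_C k D F -> class_C k D F'.
Proof.
have H (E E' : R * R -> V) : (forall z, D z -> E z = E' z) -> forall z, D z ->
    {near z, E =1 E'}.
  by move=> EE z Dz; apply: near_open Dz EE.
elim: k F F' => [|k IH] F F' FF [cF r]; split.
- by move=> z Dz; exact: near_eq_continuous (H _ _ FF z Dz) (cF z Dz).
- by [].
- by move=> z Dz; exact: near_eq_continuous (H _ _ FF z Dz) (cF z Dz).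
- case: r => dF aF bF; split.
  + by move=> z Dz; have [d1 d2] := dF z Dz; split;
      apply: near_eq_derivable (H _ _ FF z Dz) _.
  + apply: IH aF => z Dz; apply: near_eq_derive; exact: H.
  + apply: IH bF => z Dz; apply: near_eq_derive; exact: H.
Qed.

Lemma class_C_linear (V W : normedModType R) (L : {linear V -> W}) k
    (F : R * R -> V) :
  continuous L -> class_C k D F -> class_C k D (L \o F).
Proof.
move=> cL; elim: k F => [|k IH] F [cF r]; split.
- by move=> z Dz; apply: continuous_comp; [exact: cF|exact: cL].
- by [].
- by move=> z Dz; apply: continuous_comp; [exact: cF|exact: cL].
- case: r => dF aF bF.
  have dL z v : derivable F z v -> is_derive z v (L \o F) (L ('D_v F z)).
    by move=> d; apply: is_derive_linear => //; exact: derivableP.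
  split.
  + by move=> z /dF [d1 d2]; split; apply: ex_derive; apply: dL.
  + apply: class_C_ext (IH _ aF) => z /dF[d1 _].
    by rewrite /= /partial_alpha; symmetry; apply: derive_val; apply: dL.
  + apply: class_C_ext (IH _ bF) => z /dF[_ d2].
    by rewrite /= /partial_beta; symmetry; apply: derive_val; apply: dL.
Qed.

Lemma class_C_pair (V W : normedModType R) k (F : R * R -> V) (G : R * R -> W) :
  class_C k D F -> class_C k D G -> class_C k D (fun z => (F z, G z)).
Proof.
elim: k F G => [|k IH] F G [cF r] [cG s]; split.
- by move=> z Dz; apply: cvg_pair; [exact: cF|exact: cG].
- by [].
- by move=> z Dz; apply: cvg_pair; [exact: cF|exact: cG].
- case: r => dF aF bF; case: s => dG aG bG.
  have dp z v : derivable F z v -> derivable G z v ->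
      is_derive z v (fun z => (F z, G z)) ('D_v F z, 'D_v G z).
    by move=> d1 d2; apply: is_derive_pair => //; exact: derivableP.
  split.
  + by move=> z Dz; have [? ?] := dF z Dz; have [? ?] := dG z Dz;
      split; apply: ex_derive; apply: dp.
  + apply: class_C_ext (IH _ _ aF aG) => z Dz.
    have [? ?] := dF z Dz; have [? ?] := dG z Dz.
    by rewrite /= /partial_alpha; symmetry; apply: derive_val; apply: dp.
  + apply: class_C_ext (IH _ _ bF bG) => z Dz.
    have [? ?] := dF z Dz; have [? ?] := dG z Dz.
    by rewrite /= /partial_beta; symmetry; apply: derive_val; apply: dp.
Qed.

(** The increment from z to z + (s, t) is cut into a step along each axis; the mean
    value theorem on each step and the continuity of the partial derivatives at z
    bound the remainder. *)
Lemma class_C1_is_diff (u : R * R -> R) (z : R * R) :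
  class_C 1 D u -> D z ->
  is_diff z u (fun w => w.1 * partial_alpha u z + w.2 * partial_beta u z).
Proof.
move=> [cu [du [ca _] [cb _]]] Dz.
set L := fun w : R * R => _.
have lL : linear L.
  by move=> k [s t] [s' t']; rewrite /L /= /GRing.scale /=; ring.
have cL : continuous L.
  move=> w; apply: (@continuousD _ _ _ (fun w : R * R => w.1 * _)
    (fun w : R * R => w.2 * _)).
    apply: (@continuousM _ _ (fun w : R * R => w.1) (fun=> _)).
      exact: cvg_fst. exact: cvg_cst.
  apply: (@continuousM _ _ (fun w : R * R => w.2) (fun=> _)).
    exact: cvg_snd. exact: cvg_cst.
apply: is_diff_of_bound => // e e0.
have e20 : 0 < e / 2 by rewrite divr_gt0.
have nD : nbhs z D by apply: open_nbhs_nbhs.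
have na : \forall y \near z, `|partial_alpha u z - partial_alpha u y| <= e / 2.
  by have /cvgrPdist_le := ca z Dz; apply.
have nb : \forall y \near z, `|partial_beta u z - partial_beta u y| <= e / 2.
  by have /cvgrPdist_le := cb z Dz; apply.
have [r r0 rP] := (nbhs_ballP _ _).1 (filterI nD (filterI na nb)).
apply/nbhs_ballP; exists r => //= -[s t] /= [st1 st2].
rewrite /ball /= !sub0r !normrN in st1 st2.
have inb a b : `|a| < r -> `|b| < r ->
    [/\ D (z.1 + a, z.2 + b),
    `|partial_alpha u z - partial_alpha u (z.1 + a, z.2 + b)| <= e / 2 &
    `|partial_beta u z - partial_beta u (z.1 + a, z.2 + b)| <= e / 2].
  move=> ar br; have [] : ball z r (z.1 + a, z.2 + b).
    by split; rewrite /ball /= opprD addNKr normrN.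
  by move=> h1 h2; have [? []] := rP _ (conj h1 h2).
(* the step along the first axis, at height z.2 + t *)
have [a as_ Ea] : exists2 a, `|a| <= `|s| &
   u (z.1 + s, z.2 + t) - u (z.1, z.2 + t) = partial_alpha u (z.1 + a, z.2 + t) * s.
  have H a : ((z.1, z.2 + t) : R * R) + a *: (1, 0) = (z.1 + a, z.2 + t).
    by congr (_, _); rewrite /= /GRing.scale /= ?mulr1 ?mulr0 ?addr0.
  have [a|a as_] := @MVT_signed R (fun a : R => u (z.1 + a, z.2 + t))
      (fun a => partial_alpha u (z.1 + a, z.2 + t)) s.
    move=> as_; have [Da _ _] := inb _ _ (le_lt_trans as_ st1) st2.
    have [d _] := du _ Da; have := derivableP d.
    by rewrite -H => /is_derive_line; under eq_fun do rewrite H.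
  by rewrite addr0 => E; exists a.
have [b bt Eb] : exists2 b, `|b| <= `|t| &
   u (z.1, z.2 + t) - u z = partial_beta u (z.1, z.2 + b) * t.
  have H b : z + b *: (0, 1) = (z.1, z.2 + b).
    by rewrite [z in LHS]surjective_pairing; congr (_, _); rewrite /= /GRing.scale /= ?mulr1 ?mulr0 ?addr0.
  have [b|b bt] := @MVT_signed R (fun b : R => u (z.1, z.2 + b))
      (fun b => partial_beta u (z.1, z.2 + b)) t.
    move=> bt; have [] := inb 0 b _ (le_lt_trans bt st2); first by rewrite normr0.
    rewrite addr0 => Db _ _.
    have [_ d] := du _ Db; have := derivableP d.
    by rewrite -H => /is_derive_line; under eq_fun do rewrite H.
  by rewrite addr0 -surjective_pairing => E; exists b.
have [_ Ka _] := inb _ _ (le_lt_trans as_ st1) st2.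
have [|_ _] := inb 0 b _ (le_lt_trans bt st2); first by rewrite normr0.
rewrite addr0 => Kb.
have -> : z + (s, t) = (z.1 + s, z.2 + t) by [].
have -> : u (z.1 + s, z.2 + t) - u z - L (s, t) =
   - (s * (partial_alpha u z - partial_alpha u (z.1 + a, z.2 + t))) -
     (t * (partial_beta u z - partial_beta u (z.1, z.2 + b))).
  have -> : u (z.1 + s, z.2 + t) - u z =
      (u (z.1 + s, z.2 + t) - u (z.1, z.2 + t)) + (u (z.1, z.2 + t) - u z).
    by rewrite subrKA.
  by rewrite Ea Eb /L /=; ring.
rewrite (le_trans (ler_normD _ _))// !normrN !normrM.
have -> : e * `|(s, t)| = `|(s, t)| * (e / 2) + `|(s, t)| * (e / 2) by field.
have [m1 m2] : `|s| <= `|(s, t)| /\ `|t| <= `|(s, t)|.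
  by rewrite prod_normE /= !le_max !lexx orbT.
by apply: lerD; apply: ler_pM.
Qed.

Lemma class_C1_differentiable (u : R * R -> R) (z : R * R) :
  class_C 1 D u -> D z -> differentiable u z.
Proof. by move=> /class_C1_is_diff H /H []. Qed.

End class_C.

(** * Integrals over a period that depend on a parameter *)

Section circle_integral.
Variable R : realType.
Implicit Types (phi psi : R -> R).

(** The factor 1 / (2 pi) of a mean value is left out, so that the integral of a
    derivative needs no normalisation. *)
Definition circle_int phi : R :=
  \int[@lebesgue_measure R]_(t in `[0, pi *+ 2]) phi t.

Let dpi_gt0 : 0 < pi *+ 2 :> R.
Proof. by rewrite mulrn_wgt0// pi_gt0. Qed.

Lemma circle_integrable phi : continuous phi ->
  (@lebesgue_measure R).-integrable `[0, pi *+ 2] (EFin \o phi).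
Proof.
move=> cphi; apply: continuous_compact_integrable; first exact: segment_compact.
exact: continuous_subspaceT.
Qed.

Lemma circle_intB phi psi : continuous phi -> continuous psi ->
  circle_int (fun t => phi t - psi t) = circle_int phi - circle_int psi.
Proof.
by move=> c1 c2; rewrite /circle_int RintegralB//; exact: circle_integrable.
Qed.

Lemma circle_intZ phi k : continuous phi ->
  circle_int (fun t => k * phi t) = k * circle_int phi.
Proof.
by move=> c1; rewrite /circle_int RintegralZl//; exact: circle_integrable.
Qed.

Lemma circle_int_cst k : circle_int (fun=> k) = k * (pi *+ 2).
Proof.
rewrite /circle_int Rintegral_cst//= lebesgue_measure_itv /= lte_fin dpi_gt0.
by rewrite oppr0 addr0.
Qed.

Lemma circle_int_bound phi e : continuous phi ->
  (forall t, 0 <= t <= pi *+ 2 -> `|phi t| <= e) ->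
  `|circle_int phi| <= e * (pi *+ 2).
Proof.
move=> cphi phie; rewrite -circle_int_cst.
have cn : continuous (fun t => `|phi t|).
  by move=> t; apply: continuous_comp; [exact: cphi|exact: norm_continuous].
apply: le_trans (le_normr_Rintegral _ _) _ => //; first exact: circle_integrable.
apply: le_Rintegral => //; first exact: circle_integrable.
by apply: (circle_integrable (phi := fun=> e)) => t; exact: cvg_cst.
Qed.

(** A derivative of a periodic function has integral 0 over a period; in use this is
    integration by parts along a circle. *)
Lemma circle_int_derive phi psi : continuous phi ->
  (forall t : R, is_derive t 1 psi (phi t)) -> psi (pi *+ 2) = psi 0 ->
  circle_int phi = 0.
Proof.
move=> cphi dpsi E; rewrite /circle_int /Rintegral.
have cpsi : continuous psi.
  by move=> t; apply: differentiable_continuous; apply/derivable1_diffP;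
    case: (dpsi t).
rewrite (@continuous_FTC2 _ phi psi) ?E//=; first by rewrite subrr.
- exact: continuous_subspaceT.
- split.
  + by move=> t _; case: (dpsi t).
  + exact: cvg_at_right_filter (cpsi _).
  + exact: cvg_at_left_filter (cpsi _).
- by move=> t _; rewrite derive1E; case: (dpsi t).
Qed.

Section parameter.
Variable V : normedModType R.
Implicit Types (Phi : V -> R -> R) (z : V).

Definition jointly_continuous_at Phi z :=
  forall t, {for (z, t), continuous (fun p : V * R => Phi p.1 p.2)}.

Lemma jointly_continuous_snd Phi z : jointly_continuous_at Phi z ->
  continuous (Phi z).
Proof.
move=> cP t.
apply: (@continuous_comp _ _ _ (fun t => (z, t)) (fun p : V * R => Phi p.1 p.2)).
  have c1 : {for t, continuous (fun=> z : V)} by exact: cvg_cst.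
  have c2 : {for t, continuous (@id R)} by exact: cvg_id.
  exact: (cvg_pair c1 c2).
exact: cP.
Qed.

(** Compactness of the period: continuity at each point of {z} x [0, 2 pi] holds
    uniformly in the second variable. *)
Lemma jointly_continuous_unif Phi z e : jointly_continuous_at Phi z -> 0 < e ->
  \forall y \near z, forall t, 0 <= t <= pi *+ 2 -> `|Phi y t - Phi z t| <= e.
Proof.
move=> cP e0.
have K : compact `[0, pi *+ 2 : R] by exact: segment_compact.
have := (compact_near_coveringP _).1 K V (nbhs z)
  (fun y t => `|Phi y t - Phi z t| <= e) _.
have H : forall t : R, t \in `[0, pi *+ 2] ->
   \forall t' \near t & y \near z, `|Phi y t' - Phi z t'| <= e.
  move=> t _.
  have e2 : 0 < e / 2 by rewrite divr_gt0.
  have /cvgrPdist_le/(_ _ e2) H1 := cP t.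
  have /cvgrPdist_le/(_ _ e2) H2 := jointly_continuous_snd cP (x := t).
  have {}H1 : \forall t' \near t & y \near z, `|Phi z t - Phi y t'| <= e / 2.
    case: H1 => -[A B] /= [A1 B1] AB; exists (B, A) => //= -[t' y] /= [Bt Ay].
    exact: (AB (y, t')).
  have {}H2 : \forall t' \near t & y \near z, `|Phi z t - Phi z t'| <= e / 2.
    exists ([set t' | `|Phi z t - Phi z t'| <= e / 2], setT) => /=.
      by split => //; exact: filterT.
    by move=> [t' y] /= [].
  apply: filterS2 H1 H2 => -[t' y] /= H1 H2.
  rewrite -(subrKA (Phi z t)) [e]splitr.
  by apply: le_trans (ler_normD _ _) _; apply: lerD; rewrite // distrC.
by move=> /(_ _ H); apply: filterS => y P t t01; apply: P; rewrite /= in_itv.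
Qed.

Lemma circle_int_continuous Phi z :
  (\forall y \near z, jointly_continuous_at Phi y) ->
  {for z, continuous (fun y => circle_int (Phi y))}.
Proof.
move=> cP; apply/cvgrPdist_le => e e0.
have e1 : 0 < e / (pi *+ 2) by rewrite divr_gt0.
apply: filterS2 (cP) (jointly_continuous_unif (nbhs_singleton cP) e1) => y cy H.
have c1 := jointly_continuous_snd cy.
have c0 := jointly_continuous_snd (nbhs_singleton cP).
rewrite -circle_intB// -[e](divfK (lt0r_neq0 dpi_gt0)).
apply: circle_int_bound; first by move=> t; apply: continuousB; [exact: c0|exact: c1].
by move=> t /H; rewrite distrC.
Qed.

(** Differentiation under the integral sign.  By the mean value theorem a difference
    quotient of the integrand is a value of its derivative at a nearby parameter,
    and nearby means uniformly close over the period. *)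
Lemma circle_int_is_derive Phi Psi z v :
  (\forall y \near z, jointly_continuous_at Phi y) ->
  jointly_continuous_at Psi z ->
  (\forall y \near z, forall t, is_derive y v (fun y => Phi y t) (Psi y t)) ->
  is_derive z v (fun y => circle_int (Phi y)) (circle_int (Psi z)).
Proof.
move=> cPhi cPsi dPhi.
set q := fun y => circle_int (Phi y).
have C : (fun h : R => h^-1 *: ((q \o shift z) (h *: v) - q z)) @ 0^' -->
    circle_int (Psi z).
  apply/cvgrPdist_le => e e0.
  have e1 : 0 < e / (pi *+ 2) by rewrite divr_gt0.
  have U := jointly_continuous_unif cPsi e1.
  have c0 : continuous (fun h : R => z + h *: v).
    move=> h; apply: cvgD; first exact: cvg_cst.
    by apply: cvgZr_tmp; exact: cvg_id.
  pose A y := [/\ jointly_continuous_at Phi y,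
    forall t, is_derive y v (fun y => Phi y t) (Psi y t) &
    forall t, 0 <= t <= pi *+ 2 -> `|Psi y t - Psi z t| <= e / (pi *+ 2)].
  have nA : nbhs (z + 0 *: v) A.
    by rewrite scale0r addr0; apply: filterS3 cPhi dPhi U => y.
  have [r r0 rP] := (nbhs_ballP _ _).1 (c0 _ _ nA).
  apply/nbhs_ballP; exists r => // h hr h0.
  have seg (k : R) : `|k| <= `|h| -> ball (0 : R) r k.
    by move: hr; rewrite /ball /= !sub0r !normrN => hr kh; exact: le_lt_trans hr.
  have [ch _ _] := rP _ hr.
  have cz := nbhs_singleton cPhi.
  have E : h^-1 *: ((q \o shift z) (h *: v) - q z) =
      circle_int (fun t => h^-1 * (Phi (z + h *: v) t - Phi z t)).
    rewrite /q /= [h *: v + z]addrC -circle_intB; last 2 first.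
    - exact: jointly_continuous_snd ch.
    - exact: jointly_continuous_snd cz.
    rewrite circle_intZ// => t; apply: continuousB.
    - exact: (jointly_continuous_snd ch).
    - exact: (jointly_continuous_snd cz).
  have cq : continuous (fun t => h^-1 * (Phi (z + h *: v) t - Phi z t)).
    move=> t; apply: cvgM; first exact: cvg_cst.
    apply: cvgB.
    - exact: (jointly_continuous_snd ch).
    - exact: (jointly_continuous_snd cz).
  rewrite E -circle_intB//; last exact: jointly_continuous_snd.
  rewrite -[leRHS](divfK (lt0r_neq0 dpi_gt0)).
  apply: circle_int_bound.
    by move=> t; apply: cvgB; [exact: jointly_continuous_snd|exact: cq].
  move=> t t01.
  have dl (k : R) : `|k| <= `|h| -> is_derive k 1 (fun k => Phi (z + k *: v) t)
      (Psi (z + k *: v) t).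
    move=> kh; have [_ d _] := rP _ (seg _ kh).
    exact: (is_derive_line (d t)).
  have [k kh ->] : exists2 k, `|k| <= `|h| &
      h^-1 * (Phi (z + h *: v) t - Phi z t) = Psi (z + k *: v) t.
    have [k kh] := MVT_signed dl; rewrite scale0r addr0 => ->.
    by exists k => //; rewrite mulrCA mulVf// mulr1.
  by have [_ _ b] := rP _ (seg _ kh); rewrite distrC; exact: b.
by apply: DeriveDef; [apply/cvg_ex; exists (circle_int (Psi z))|exact: cvg_lim].
Qed.

End parameter.
End circle_integral.

(** * A Cauchy-type formula for the derivative of a holomorphic function *)

Section cauchy_riemann.
Variable R : realType.
Implicit Types (D : set (R * R)) (u v p q : R * R -> R) (y z w : R * R).

(** These equations say that u + i v is holomorphic.  The values may lie in any
    normed space, since the stem functions take quaternionic values. *)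
Definition cauchy_riemann (V : normedModType R) D (u v : R * R -> V) :=
  forall z, D z ->
  partial_alpha u z = partial_beta v z /\ partial_beta u z = - partial_alpha v z.

Definition on_circle z (r t : R) : R * R := (z.1 + r * cos t, z.2 + r * sin t).

(** The flux of the vector field (p, q) through the circle of radius r about z,
    divided by r.  With the Cauchy-Riemann equations the field (u, v) has divergence
    2 u_alpha.  In complex notation this is the real part of the integral of
    (p + i q) exp (- i t). *)
Definition circle_flux p q z (r : R) : R :=
  circle_int (fun t => p (on_circle z r t) * cos t + q (on_circle z r t) * sin t).

Lemma on_circle_continuous : continuous (fun x : (R * R) * R * R =>
  on_circle x.1.1 x.1.2 x.2).
Proof.
move=> x.
have c1 : {for x, continuous (fun x : (R * R) * R * R => x.1.1.1)}.
  apply: (@continuous_comp _ _ _ (fun x : (R * R) * R * R => x.1.1) fst);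
    last exact: cvg_fst.
  apply: (@continuous_comp _ _ _ (fun x : (R * R) * R * R => x.1) fst); exact: cvg_fst.
have c2 : {for x, continuous (fun x : (R * R) * R * R => x.1.1.2)}.
  apply: (@continuous_comp _ _ _ (fun x : (R * R) * R * R => x.1.1) snd);
    last exact: cvg_snd.
  apply: (@continuous_comp _ _ _ (fun x : (R * R) * R * R => x.1) fst); exact: cvg_fst.
have c3 : {for x, continuous (fun x : (R * R) * R * R => x.1.2)}.
  apply: (@continuous_comp _ _ _ (fun x : (R * R) * R * R => x.1) snd);
    [exact: cvg_fst | exact: cvg_snd].
have c4 : {for x, continuous (fun x : (R * R) * R * R => cos x.2)}.
  by apply: continuous_comp; [exact: cvg_snd | exact: continuous_cos].
have c5 : {for x, continuous (fun x : (R * R) * R * R => sin x.2)}.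
  by apply: continuous_comp; [exact: cvg_snd | exact: continuous_sin].
exact: (cvg_pair (cvgD c1 (cvgM c3 c4)) (cvgD c2 (cvgM c3 c5))).
Qed.

Lemma jointly_continuous_circle (V : normedModType R) (P : V -> R * R * R) p
    (c : R -> R) (x : V) :
  {for x, continuous P} -> continuous c ->
  (forall t, {for on_circle (P x).1 (P x).2 t, continuous p}) ->
  jointly_continuous_at (fun x t => p (on_circle (P x).1 (P x).2 t) * c t) x.
Proof.
move=> cP cc cp t; apply: cvgM.
  have c1 : {for (x, t), continuous (fun s : V * R => (P s.1, s.2))}.
    have k1 : {for (x, t), continuous (fun s : V * R => P s.1)}.
      by apply: (@continuous_comp _ _ _ fst P); [exact: cvg_fst|exact: cP].
    have k2 : {for (x, t), continuous (fun s : V * R => s.2)} by exact: cvg_snd.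
    exact: (cvg_pair k1 k2).
  have c2 : {for (x, t), continuous (fun s : V * R =>
      on_circle (P s.1).1 (P s.1).2 s.2)}.
    exact: (continuous_comp c1 (@on_circle_continuous _)).
  exact: (continuous_comp c2 (cp t)).
by apply: continuous_comp; [exact: cvg_snd|exact: cc].
Qed.

Lemma jointly_continuousD (V : normedModType R) (Phi Psi : V -> R -> R) (x : V) :
  jointly_continuous_at Phi x -> jointly_continuous_at Psi x ->
  jointly_continuous_at (fun x t => Phi x t + Psi x t) x.
Proof. by move=> c1 c2 t; apply: cvgD; [exact: c1|exact: c2]. Qed.

Lemma is_derive_radius z (r t : R) :
  is_derive r 1 (fun r => on_circle z r t) (cos t, sin t).
Proof.
by apply: is_derive_pair; apply: is_derive_eq; rewrite /GRing.scale /=; ring.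
Qed.

Lemma is_derive_angle z (r t : R) :
  is_derive t 1 (on_circle z r) (- (r * sin t), r * cos t).
Proof.
by apply: is_derive_pair; apply: is_derive_eq; rewrite /GRing.scale /=; ring.
Qed.

Lemma on_circle0 z t : on_circle z 0 t = z.
Proof. by rewrite /on_circle !mul0r !addr0 -surjective_pairing. Qed.

Section fixed_domain.
Variables (D : set (R * R)) (u v : R * R -> R).
Hypotheses (Dopen : open D) (Cu : class_C 1 D u) (Cv : class_C 1 D v).

Section mean_formula.
Hypothesis uv_CR : cauchy_riemann D u v.
Variables (z : R * R) (r : R).
Hypothesis r_gt0 : 0 < r.
Hypothesis zD : forall l t, `|l| < 2 * r -> D (on_circle z l t).

Let M (l : R) := circle_int (fun t => partial_alpha u (on_circle z l t)).

Let cont_alpha y : D y -> {for y, continuous (partial_alpha u)}.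
Proof. by move=> Dy; case: Cu => _ [_ [ca _] _]; exact: ca. Qed.

Let near_l (l : R) : `|l| < 2 * r -> \forall k \near l, `|k| < 2 * r.
Proof.
move=> lr; have c : {for l, continuous (fun k : R => `|k|)}.
  exact: norm_continuous.
have := @cvgr_lt R R (nbhs l) _ (fun k : R => `|k|) `|l| c (2 * r) lr.
exact.
Qed.

Let JC p c (l : R) : (forall y, D y -> {for y, continuous p}) -> continuous c ->
  `|l| < 2 * r -> jointly_continuous_at (fun l t => p (on_circle z l t) * c t) l.
Proof.
move=> cp cc lr.
have cP : {for l, continuous (fun l : R => (z, l))}.
  have k1 : {for l, continuous (fun=> z : R * R)} by exact: cvg_cst.
  have k2 : {for l, continuous (@id R)} by exact: cvg_id.
  exact: (cvg_pair k1 k2).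
by apply: (jointly_continuous_circle cP) => // t; apply/cp/zD.
Qed.

Let JCM (l : R) : `|l| < 2 * r ->
  jointly_continuous_at (fun l t => partial_alpha u (on_circle z l t)) l.
Proof.
move=> lr; have := @JC (partial_alpha u) (fun=> 1) l cont_alpha _ lr.
have -> : (fun l t => partial_alpha u (on_circle z l t) * 1) =
   (fun l t => partial_alpha u (on_circle z l t)).
  by apply/funext => k; apply/funext => t; rewrite mulr1.
by apply=> t; exact: cvg_cst.
Qed.

Let cont_M (l : R) : `|l| < 2 * r -> {for l, continuous M}.
Proof.
move=> lr; apply: circle_int_continuous.
by apply: filterS (near_l lr); exact: JCM.
Qed.

Let du y w : D y -> 'd u y w = w.1 * partial_alpha u y + w.2 * partial_beta u y.
Proof. by move=> Dy; case: (class_C1_is_diff Dopen Cu Dy) => _ ->. Qed.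

Let dv y w : D y -> 'd v y w = w.1 * partial_alpha v y + w.2 * partial_beta v y.
Proof. by move=> Dy; case: (class_C1_is_diff Dopen Cv Dy) => _ ->. Qed.

Let derive_mean (l : R) : `|l| < 2 * r ->
  is_derive l 1 (circle_flux u v z) (M l).
Proof.
move=> lr; apply: (@circle_int_is_derive _ _
  (fun l t => u (on_circle z l t) * cos t + v (on_circle z l t) * sin t)
  (fun l t => partial_alpha u (on_circle z l t))).
- apply: filterS (near_l lr) => k kr; apply: jointly_continuousD; apply: JC => //.
  + by move=> y; exact: class_C_continuous Cu.
  + exact: continuous_cos.
  + by move=> y; exact: class_C_continuous Cv.
  + exact: continuous_sin.
- exact: JCM.
- apply: filterS (near_l lr) => k kr t.
  have Dk := zD t kr.
  have d1 := is_derive_comp_diff (is_derive_radius z k t)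
    (class_C1_differentiable Dopen Cu Dk).
  have d2 := is_derive_comp_diff (is_derive_radius z k t)
    (class_C1_differentiable Dopen Cv Dk).
  rewrite du// in d1; rewrite dv// in d2.
  apply: is_derive_eq.
  have [-> ->] := uv_CR Dk; rewrite /GRing.scale /=.
  rewrite -[RHS]mulr1 -(cos2Dsin2 t); ring.
Qed.

Let mean_eq (l : R) : `|l| < 2 * r -> circle_flux u v z l = l * M l.
Proof.
move=> lr.
have c1 : continuous (fun t => u (on_circle z l t) * cos t + v (on_circle z l t) * sin t).
  apply: (jointly_continuous_snd (Phi := fun l t => u (on_circle z l t) * cos t +
     v (on_circle z l t) * sin t)).
  apply: jointly_continuousD; apply: JC => //.
  + by move=> y; exact: class_C_continuous Cu.
  + exact: continuous_cos.
  + by move=> y; exact: class_C_continuous Cv.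
  + exact: continuous_sin.
have c2 := jointly_continuous_snd (JCM lr).
apply/eqP; rewrite -subr_eq0 -circle_intZ// -circle_intB//; last first.
  by move=> t; apply: cvgM; [exact: cvg_cst|exact: c2].
apply/eqP; apply: (@circle_int_derive _ _ (fun t => u (on_circle z l t) * sin t -
   v (on_circle z l t) * cos t)).
- by move=> t; apply: cvgB; [exact: c1|apply: cvgM; [exact: cvg_cst|exact: c2]].
- move=> t.
  have Dl := zD t lr.
  have d1 := is_derive_comp_diff (is_derive_angle z l t)
    (class_C1_differentiable Dopen Cu Dl).
  have d2 := is_derive_comp_diff (is_derive_angle z l t)
    (class_C1_differentiable Dopen Cv Dl).
  rewrite du// in d1; rewrite dv// in d2.
  apply: is_derive_eq.
  have [-> ->] := uv_CR Dl; rewrite /GRing.scale /=.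
  set b := partial_beta v _; rewrite -[in RHS](mulr1 (l * b)) -(cos2Dsin2 t); ring.
- by rewrite /on_circle sin2pi cos2pi sin0 cos0.
Qed.

(** The integral M of u_alpha over circles satisfies l M(l) = m(l) and M(l) = m'(l)
    for the flux m, so M' = 0 and M(r) = M(0) = 2 pi u_alpha(z). *)
Lemma circle_flux_holomorphic :
  circle_flux u v z r = r * (pi *+ 2) * partial_alpha u z.
Proof.
have r2 : `|r| < 2 * r by rewrite gtr0_norm// mulr_natl mulr2n ltrDl.
rewrite mean_eq//.
suff -> : M r = M 0.
  rewrite /M; under [X in circle_int X]eq_fun do rewrite on_circle0.
  by rewrite circle_int_cst; ring.
have small (l : R) : 0 <= l <= r -> `|l| < 2 * r.
  by move=> /andP[l0 lr]; rewrite ger0_norm// (le_lt_trans lr)// -{1}(gtr0_norm r_gt0).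
have [||l lI] := @MVT _ M (fun=> 0) 0 r r_gt0.
- move=> l; rewrite in_itv /= => /andP[l0 lr].
  have lr2 := small l; rewrite !ltW//= in lr2; have {}lr2 := lr2 isT.
  apply: (@near_eq_is_derive R R R (fun l : R => l^-1 * circle_flux u v z l) M l 1 0).
    have : \forall k \near l, 0 < k by exact: lt_nbhsr.
    apply: filterS2 (near_l lr2) => k kr k0.
    by rewrite mean_eq// mulKf// gt_eqF.
  have dm := derive_mean lr2.
  have l0' : l != 0 by rewrite gt_eqF.
  have dV := is_deriveV l0' (is_derive_id l 1).
  have dV2 := is_deriveM dV dm.
  apply: (is_derive_eq dV2).
  rewrite mean_eq// /GRing.scale /=; field.
  exact: l0'.
- apply: continuous_in_subspaceT => l; rewrite inE /= in_itv /= => /small.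
  exact: cont_M.
- by rewrite mul0r => /eqP; rewrite subr_eq0 => /eqP.
Qed.

End mean_formula.
End fixed_domain.
End cauchy_riemann.

(** * Holomorphic functions are of every class C^k *)

(** The normed structure of the quaternions is that of R^4.  Rewriting with this
    equation transports results that do not involve the multiplication. *)
Lemma quatE (R : realType) : quat R = (R * R * R * R)%type :> normedModType R.
Proof. reflexivity. Qed.

Lemma dquatE (R : realType) : dquat R = (quat R * quat R)%type :> normedModType R.
Proof. reflexivity. Qed.

Section regularity.
Variables (R : realType) (D : set (R * R)).
Hypothesis Dopen : open D.
Implicit Types (u v p q : R * R -> R) (y z w : R * R).

Section disc.
Variables (z : R * R) (r : R).
Hypotheses (r_gt0 : 0 < r) (zD : ball z (3 * r) `<=` D).

(** The norm of R x R is the sup norm, so a circle of radius less than 2 r about a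
    point at distance less than r from z stays in the ball of radius 3 r. *)
Lemma on_circle_in y (l t : R) : ball z r y -> `|l| < 2 * r -> D (on_circle y l t).
Proof.
move=> [y1 y2] lr; apply: zD.
have bd (a b c : R) : ball a r b -> `|c| <= 1 -> ball a (3 * r) (b + l * c).
  rewrite /ball /= opprD addrA => ab c1.
  apply: le_lt_trans (ler_normB _ _) _.
  have -> : 3 * r = r + 2 * r by ring.
  apply: ltrD => //; apply: le_lt_trans lr.
  by rewrite normrM ler_piMr.
split; apply: bd => //.
- by rewrite ler_norml cos_geN1 cos_le1.
- by rewrite ler_norml sin_geN1 sin_le1.
Qed.

Let r2 : `|r| < 2 * r.
Proof. by rewrite gtr0_norm// mulr_natl mulr2n ltrDl. Qed.

Let near_disc y : ball z r y -> \forall x \near y, ball z r x.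
Proof. by move=> zy; apply: open_nbhs_nbhs; split => //; exact: ball_open. Qed.

Lemma jointly_continuous_flux p q y :
  (forall x, D x -> {for x, continuous p}) ->
  (forall x, D x -> {for x, continuous q}) -> ball z r y ->
  jointly_continuous_at (fun y t => p (on_circle y r t) * cos t +
                                    q (on_circle y r t) * sin t) y.
Proof.
move=> cp cq zy.
have cP : {for y, continuous (fun y => (y, r))}.
  have k1 : {for y, continuous (fun=> r)} by exact: cvg_cst.
  have k2 : {for y, continuous (@id (R * R))} by exact: cvg_id.
  exact: (cvg_pair k2 k1).
apply: jointly_continuousD; apply: (jointly_continuous_circle cP).
- exact: continuous_cos.
- by move=> t; apply/cp/on_circle_in.
- exact: continuous_sin.
- by move=> t; apply/cq/on_circle_in.
Qed.

Lemma circle_flux_continuous p q y :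
  (forall x, D x -> {for x, continuous p}) ->
  (forall x, D x -> {for x, continuous q}) -> ball z r y ->
  {for y, continuous (fun y => circle_flux p q y r)}.
Proof.
move=> cp cq zy; apply: (@circle_int_continuous _ _
  (fun y t => p (on_circle y r t) * cos t + q (on_circle y r t) * sin t)).
by apply: filterS (near_disc zy) => x; exact: jointly_continuous_flux.
Qed.

Lemma circle_flux_is_derive p q p' q' w y :
  (forall x, D x -> {for x, continuous p} /\ {for x, continuous q}) ->
  (forall x, D x -> {for x, continuous p'} /\ {for x, continuous q'}) ->
  (forall x, D x -> is_derive x w p (p' x) /\ is_derive x w q (q' x)) ->
  ball z r y ->
  is_derive y w (fun y => circle_flux p q y r) (circle_flux p' q' y r).
Proof.
move=> cpq cpq' dpq zy; apply: (@circle_int_is_derive _ _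
  (fun y t => p (on_circle y r t) * cos t + q (on_circle y r t) * sin t)
  (fun y t => p' (on_circle y r t) * cos t + q' (on_circle y r t) * sin t)).
- apply: filterS (near_disc zy) => x.
  by apply: jointly_continuous_flux => ? /cpq[].
- by apply: jointly_continuous_flux => // ? /cpq'[].
- apply: filterS (near_disc zy) => x zx t.
  have [dp dq] := dpq _ (on_circle_in t zx r2).
  have ET (f : R * R -> R) : (fun y => f (on_circle y r t)) =
     (fun y => f (y + (r * cos t, r * sin t))) by [].
  have {}dp := is_derive_translate (dp : is_derive (x + (r * cos t, r * sin t)) w p _).
  have {}dq := is_derive_translate (dq : is_derive (x + (r * cos t, r * sin t)) w q _).
  rewrite -ET in dp; rewrite -ET in dq.
  by apply: is_derive_eq; rewrite /GRing.scale /=; ring.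
Qed.

Lemma partial_alpha_mean u v y : class_C 1 D u -> class_C 1 D v ->
  cauchy_riemann D u v -> ball z r y ->
  partial_alpha u y = (r * (pi *+ 2))^-1 * circle_flux u v y r.
Proof.
move=> Cu Cv uv zy.
rewrite (circle_flux_holomorphic Dopen Cu Cv uv r_gt0).
  by rewrite mulKf// mulf_neq0// ?gt_eqF// mulrn_wgt0// pi_gt0.
by move=> l t; exact: on_circle_in.
Qed.

(** Near z the derivative u_alpha is a flux integral of u and v, and that integral
    is differentiated by differentiating u and v only. *)
Lemma partial_alpha_is_derive u v w y : class_C 1 D u -> class_C 1 D v ->
  cauchy_riemann D u v ->
  (forall x, D x -> {for x, continuous ('D_w u)} /\ {for x, continuous ('D_w v)}) ->
  (forall x, D x -> derivable u x w /\ derivable v x w) ->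
  ball z r y ->
  is_derive y w (partial_alpha u)
    ((r * (pi *+ 2))^-1 * circle_flux ('D_w u) ('D_w v) y r).
Proof.
move=> Cu Cv uv cw dw zy.
apply: (@near_eq_is_derive R _ _
    (fun y => (r * (pi *+ 2))^-1 * circle_flux u v y r)).
  apply: filterS (near_disc zy) => x zx.
  by rewrite (partial_alpha_mean Cu Cv uv zx).
apply: is_deriveZ; apply: circle_flux_is_derive => // x Dx.
- by split; [exact: class_C_continuous Cu Dx|exact: class_C_continuous Cv Dx].
- by have [d1 d2] := dw x Dx; split; exact: derivableP.
Qed.

End disc.

(** Multiplication of u + i v by - i.  It turns statements about the first component
    into statements about the second one. *)
Lemma cauchy_riemann_rot (V : normedModType R) (u v : R * R -> V) :
  class_C 1 D u -> cauchy_riemann D u v -> cauchy_riemann D v (fun z => - u z).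
Proof.
move=> [_ [du _ _]] uv z Dz; have [d1 d2] := du z Dz; have [e1 e2] := uv z Dz.
have nE : (fun z => - u z) = - u by [].
rewrite /partial_alpha /partial_beta nE !deriveN//.
by move: e1 e2; rewrite /partial_alpha /partial_beta => -> ->; rewrite !opprK.
Qed.

Lemma class_CN (V : normedModType R) k (u : R * R -> V) :
  class_C k D u -> class_C k D (fun z => - u z).
Proof.
pose N : {linear V -> V} := -%R.
have cN : continuous N by exact: opp_continuous.
exact: (@class_C_linear R D Dopen V V N k u cN).
Qed.

Lemma disc_exists z : D z -> exists2 r, 0 < r & ball z (3 * r) `<=` D.
Proof.
move=> Dz; have [e e0 eD] := (nbhs_ballP _ _).1 (open_nbhs_nbhs (conj Dopen Dz)).
exists (e / 3); first by rewrite divr_gt0.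
by have -> : 3 * (e / 3) = e by field.
Qed.

(** Near each point the derivatives of u_alpha are flux integrals of the continuous
    derivatives of u and v, hence continuous. *)
Lemma class_C1_partial_alpha u v : class_C 1 D u -> class_C 1 D v ->
  cauchy_riemann D u v -> class_C 1 D (partial_alpha u).
Proof.
move=> Cu Cv uv.
have [_ [du [cau _] [cbu _]]] := Cu.
have [_ [dv [cav _] [cbv _]]] := Cv.
have H w : (forall x, D x -> {for x, continuous ('D_w u)} /\
                             {for x, continuous ('D_w v)}) ->
    (forall x, D x -> derivable u x w /\ derivable v x w) ->
    forall z, D z -> derivable (partial_alpha u) z w /\
      {for z, continuous ('D_w (partial_alpha u))}.
  move=> cw dw z /disc_exists[r r0 rD].
  have d y zy := @partial_alpha_is_derive z r r0 rD u v w y Cu Cv uv cw dw zy.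
  have zz : ball z r z by exact: ballxx.
  split; first by case: (d z zz).
  have c1 := @circle_flux_continuous z r r0 rD ('D_w u) ('D_w v) z
    (fun x Dx => (cw x Dx).1) (fun x Dx => (cw x Dx).2) zz.
  have c2 : {for z, continuous (fun y =>
      (r * (pi *+ 2))^-1 * circle_flux ('D_w u) ('D_w v) y r)}.
    by apply: cvgM; [exact: cvg_cst|exact: c1].
  have n : {near z, (fun y => (r * (pi *+ 2))^-1 *
     circle_flux ('D_w u) ('D_w v) y r) =1 'D_w (partial_alpha u)}.
    have : \forall x \near z, ball z r x.
      by apply: open_nbhs_nbhs; split => //; exact: ball_open.
    by apply: filterS => y /d [_ ->].
  exact: near_eq_continuous n c2.
have Ha := H (1, 0) (fun x Dx => conj (cau x Dx) (cav x Dx))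
  (fun x Dx => conj (du x Dx).1 (dv x Dx).1).
have Hb := H (0, 1) (fun x Dx => conj (cbu x Dx) (cbv x Dx))
  (fun x Dx => conj (du x Dx).2 (dv x Dx).2).
split; first exact: cau.
split.
- by move=> x Dx; split; [exact: (Ha x Dx).1|exact: (Hb x Dx).1].
- exact: (conj (fun x Dx => (Ha x Dx).2) I).
- exact: (conj (fun x Dx => (Hb x Dx).2) I).
Qed.

(** The derivative of a holomorphic function is holomorphic: the flux formulas for
    u_alpha and v_alpha, differentiated under the integral, have integrands that
    correspond by the Cauchy-Riemann equations of u and v. *)
Lemma cauchy_riemann_partial_alpha u v : class_C 1 D u -> class_C 1 D v ->
  cauchy_riemann D u v ->
  cauchy_riemann D (partial_alpha u) (partial_alpha v).
Proof.
move=> Cu Cv uv z Dz.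
have Cu' := class_CN Cu.
have vu := cauchy_riemann_rot Cu uv.
have [_ [du [cau _] [cbu _]]] := Cu.
have [_ [dv [cav _] [cbv _]]] := Cv.
have [_ [du' [cau' _] [cbu' _]]] := Cu'.
have [r r0 rD] := disc_exists Dz.
have zz : ball z r z by exact: ballxx.
have ua := @partial_alpha_is_derive z r r0 rD u v (1, 0) z Cu Cv uv
  (fun x Dx => conj (cau x Dx) (cav x Dx))
  (fun x Dx => conj (du x Dx).1 (dv x Dx).1) zz.
have ub := @partial_alpha_is_derive z r r0 rD u v (0, 1) z Cu Cv uv
  (fun x Dx => conj (cbu x Dx) (cbv x Dx))
  (fun x Dx => conj (du x Dx).2 (dv x Dx).2) zz.
have va := @partial_alpha_is_derive z r r0 rD v _ (1, 0) z Cv Cu' vu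
  (fun x Dx => conj (cav x Dx) (cau' x Dx))
  (fun x Dx => conj (dv x Dx).1 (du' x Dx).1) zz.
have vb := @partial_alpha_is_derive z r r0 rD v _ (0, 1) z Cv Cu' vu
  (fun x Dx => conj (cbv x Dx) (cbu' x Dx))
  (fun x Dx => conj (dv x Dx).2 (du' x Dx).2) zz.
rewrite [partial_alpha (partial_alpha u) z]/partial_alpha (derive_val (is_derive := ua)).
rewrite [partial_beta (partial_alpha v) z]/partial_beta (derive_val (is_derive := vb)).
rewrite [partial_beta (partial_alpha u) z]/partial_beta (derive_val (is_derive := ub)).
rewrite [partial_alpha (partial_alpha v) z]/partial_alpha (derive_val (is_derive := va)).
have r2 : `|r| < 2 * r by rewrite gtr0_norm// mulr_natl mulr2n ltrDl.
split.
  congr (_ * circle_int _); apply/funext => t.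
  have Dt := on_circle_in rD t zz r2.
  have [e1 _] := uv _ Dt; have [e2 _] := vu _ Dt.
  by move: e1 e2; rewrite /partial_alpha /partial_beta => -> ->.
rewrite -mulrN; congr (_ * _); rewrite -mulN1r /circle_flux -circle_intZ.
  congr circle_int; apply/funext => t.
  have Dt := on_circle_in rD t zz r2.
  have [_ e1] := uv _ Dt; have [_ e2] := vu _ Dt.
  by move: e1 e2; rewrite /partial_alpha /partial_beta => -> ->; ring.
exact: (jointly_continuous_snd (jointly_continuous_flux r0 rD cav cau' zz)).
Qed.

(** The induction needs u_beta as well: it is - v_alpha on D, where v is the first
    component of the rotated pair. *)
Lemma class_C_holomorphic_real k u v : class_C 1 D u -> class_C 1 D v ->
  cauchy_riemann D u v -> class_C k D u.
Proof.
elim: k u v => [|k IH] u v Cu Cv uv.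
  by split => // z Dz; exact: class_C_continuous Cu Dz.
have Cu' := class_CN Cu.
have Cv' := class_CN Cv.
have vu := cauchy_riemann_rot Cu uv.
have uv' := cauchy_riemann_rot Cv vu.
have [_ [du _ _]] := Cu.
split; first by move=> z Dz; exact: class_C_continuous Cu Dz.
have Cau := class_C1_partial_alpha Cu Cv uv.
have Cav := class_C1_partial_alpha Cv Cu' vu.
have Cau' := class_C1_partial_alpha Cu' Cv' uv'.
split; first exact: du.
- exact: (IH _ _ Cau Cav (cauchy_riemann_partial_alpha Cu Cv uv)).
- have := IH _ _ Cav Cau' (cauchy_riemann_partial_alpha Cv Cu' vu).
  move=> /class_CN; apply: (class_C_ext Dopen) => z Dz.
  by have [_ ->] := uv z Dz.
Qed.

(** Stated for a space of values so that it can be transported from R to its finite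
    products, among them the quaternions and the dual quaternions. *)
Definition holomorphic_smooth (V : normedModType R) :=
  forall k (u v : R * R -> V), class_C 1 D u -> class_C 1 D v ->
  cauchy_riemann D u v -> class_C k D u.

(** The projections are linear and continuous, so they preserve both class C^1 and
    the Cauchy-Riemann equations. *)
Lemma holomorphic_smooth_prod (V W : normedModType R) :
  holomorphic_smooth V -> holomorphic_smooth W ->
  holomorphic_smooth (V * W)%type.
Proof.
move=> hV hW k u v Cu Cv uv.
pose p1 : {linear (V * W)%type -> V} := fst.
pose p2 : {linear (V * W)%type -> W} := snd.
have c1 : continuous p1 by move=> x; exact: cvg_fst.
have c2 : continuous p2 by move=> x; exact: cvg_snd.
have CRL (X : normedModType R) (L : {linear (V * W)%type -> X}) : continuous L ->
    cauchy_riemann D (L \o u) (L \o v).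
  move=> cL z Dz.
  have [_ [du _ _]] := Cu; have [_ [dv _ _]] := Cv.
  have [du1 du2] := du z Dz; have [dv1 dv2] := dv z Dz.
  have D1 (f : R * R -> V * W) w : derivable f z w -> 'D_w (L \o f) z = L ('D_w f z).
    by move=> d; have [_] := is_derive_linear cL (derivableP d).
  have [e1 e2] := uv z Dz.
  rewrite /partial_alpha /partial_beta (D1 _ _ du1) (D1 _ _ du2) (D1 _ _ dv1) (D1 _ _ dv2) -linearN.
  split; congr (L _).
    exact: e1.
  exact: e2.
have u1 := hV k _ _ (class_C_linear Dopen c1 Cu) (class_C_linear Dopen c1 Cv) (CRL _ _ c1).
have u2 := hW k _ _ (class_C_linear Dopen c2 Cu) (class_C_linear Dopen c2 Cv) (CRL _ _ c2).
by apply: (class_C_ext Dopen) (class_C_pair Dopen u1 u2) => z _; rewrite -surjective_pairing.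
Qed.

Lemma holomorphic_smooth_quat : holomorphic_smooth (quat R).
Proof.
have hR : holomorphic_smooth R := class_C_holomorphic_real.
rewrite quatE; apply: holomorphic_smooth_prod (hR).
by apply: holomorphic_smooth_prod (hR); exact: holomorphic_smooth_prod.
Qed.

Lemma holomorphic_smooth_dquat : holomorphic_smooth (dquat R).
Proof. by rewrite dquatE; apply: holomorphic_smooth_prod; exact: holomorphic_smooth_quat. Qed.

Definition C1_differentiable (V : normedModType R) := forall u : R * R -> V,
  class_C 1 D u -> forall z, D z -> differentiable u z.

Lemma C1_differentiable_prod (V W : normedModType R) :
  C1_differentiable V -> C1_differentiable W -> C1_differentiable (V * W)%type.
Proof.
move=> hV hW w Cw y Dy.
pose p1 : {linear (V * W)%type -> V} := fst.
pose p2 : {linear (V * W)%type -> W} := snd.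
have c1 : continuous p1 by move=> x; exact: cvg_fst.
have c2 : continuous p2 by move=> x; exact: cvg_snd.
have d1 := hV _ (class_C_linear Dopen c1 Cw) y Dy.
have d2 := hW _ (class_C_linear Dopen c2 Cw) y Dy.
have -> : w = (fun x => ((p1 \o w) x, (p2 \o w) x)).
  by apply/funext => x; exact: surjective_pairing.
exact: differentiable_pair.
Qed.

Lemma C1_differentiable_quat : C1_differentiable (quat R).
Proof.
have hR : C1_differentiable R by move=> w Cw y Dy; exact: class_C1_differentiable Cw Dy.
rewrite quatE; apply: C1_differentiable_prod (hR).
by apply: C1_differentiable_prod (hR); exact: C1_differentiable_prod.
Qed.

End regularity.

(** * The quaternion algebra as a normed algebra *)

Section quaternions.
Variable R : realType.
Implicit Types (x y J K : quat R).

Definition q0 x : R := x.1.1.1.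
Definition q1 x : R := x.1.1.2.
Definition q2 x : R := x.1.2.
Definition q3 x : R := x.2.

Lemma quat_eta x : x = (q0 x, q1 x, q2 x, q3 x).
Proof. by case: x => [[[a b] c] d]. Qed.

Lemma mulqE x y : x * y =
  (q0 x * q0 y - q1 x * q1 y - q2 x * q2 y - q3 x * q3 y,
   q0 x * q1 y + q1 x * q0 y + q2 x * q3 y - q3 x * q2 y,
   q0 x * q2 y - q1 x * q3 y + q2 x * q0 y + q3 x * q1 y,
   q0 x * q3 y + q1 x * q2 y - q2 x * q1 y + q3 x * q0 y).
Proof. by move: x y => [[[a b] c] d] [[[a' b'] c'] d']. Qed.

Lemma q0_linear k x y : q0 (k *: x + y) = k * q0 x + q0 y. Proof. by []. Qed.
Lemma q1_linear k x y : q1 (k *: x + y) = k * q1 x + q1 y. Proof. by []. Qed.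
Lemma q2_linear k x y : q2 (k *: x + y) = k * q2 x + q2 y. Proof. by []. Qed.
Lemma q3_linear k x y : q3 (k *: x + y) = k * q3 x + q3 y. Proof. by []. Qed.

Lemma coordZ k x : (q0 (k *: x) = k * q0 x) * (q1 (k *: x) = k * q1 x) *
  (q2 (k *: x) = k * q2 x) * (q3 (k *: x) = k * q3 x).
Proof. by []. Qed.

Lemma coordD x y : (q0 (x + y) = q0 x + q0 y) * (q1 (x + y) = q1 x + q1 y) *
  (q2 (x + y) = q2 x + q2 y) * (q3 (x + y) = q3 x + q3 y).
Proof. by []. Qed.

Lemma coord1 : (q0 1 = 1) * (q1 1 = 0) * (q2 1 = 0) * (q3 1 = 0).
Proof. by []. Qed.

Definition qlinE := (coordZ, coordD, coord1).

Lemma q0_continuous : continuous q0.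
Proof.
move=> x; apply: (@continuous_comp _ _ _ (fun x : R * R * R * R => x.1.1) fst);
  last exact: cvg_fst.
by apply: (@continuous_comp _ _ _ (fun x : R * R * R * R => x.1) fst); exact: cvg_fst.
Qed.

Lemma q1_continuous : continuous q1.
Proof.
move=> x; apply: (@continuous_comp _ _ _ (fun x : R * R * R * R => x.1.1) snd);
  last exact: cvg_snd.
by apply: (@continuous_comp _ _ _ (fun x : R * R * R * R => x.1) fst); exact: cvg_fst.
Qed.

Lemma q2_continuous : continuous q2.
Proof.
move=> x.
by apply: (@continuous_comp _ _ _ (fun x : R * R * R * R => x.1) snd);
  [exact: cvg_fst | exact: cvg_snd].
Qed.

Lemma q3_continuous : continuous q3.
Proof. by move=> x; exact: cvg_snd. Qed.

Lemma quat_continuous (T : topologicalType) (f : T -> quat R) (t : T) :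
  {for t, continuous (q0 \o f)} -> {for t, continuous (q1 \o f)} ->
  {for t, continuous (q2 \o f)} -> {for t, continuous (q3 \o f)} ->
  {for t, continuous f}.
Proof.
move=> c0 c1 c2 c3.
have H : {for t, continuous (fun t => (q0 (f t), q1 (f t), q2 (f t), q3 (f t)))}.
  exact: (cvg_pair (cvg_pair (cvg_pair c0 c1) c2) c3).
have E : f = (fun t => (q0 (f t), q1 (f t), q2 (f t), q3 (f t))).
  by apply/funext => s; exact: quat_eta.
by rewrite E; exact: H.
Qed.

Lemma mulq_continuous : continuous (fun p : quat R * quat R => p.1 * p.2).
Proof.
move=> p.
have l (q : quat R -> R) : continuous q ->
    {for p, continuous (fun p : quat R * quat R => q p.1)}.
  by move=> cq; apply: (@continuous_comp _ _ _ fst q); [exact: cvg_fst|exact: cq].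
have r (q : quat R -> R) : continuous q ->
    {for p, continuous (fun p : quat R * quat R => q p.2)}.
  by move=> cq; apply: (@continuous_comp _ _ _ snd q); [exact: cvg_snd|exact: cq].
have l0 := l _ q0_continuous; have l1 := l _ q1_continuous.
have l2 := l _ q2_continuous; have l3 := l _ q3_continuous.
have r0 := r _ q0_continuous; have r1 := r _ q1_continuous.
have r2 := r _ q2_continuous; have r3 := r _ q3_continuous.
have E : (fun p : quat R * quat R => p.1 * p.2) = (fun p =>
  (q0 p.1 * q0 p.2 - q1 p.1 * q1 p.2 - q2 p.1 * q2 p.2 - q3 p.1 * q3 p.2,
   q0 p.1 * q1 p.2 + q1 p.1 * q0 p.2 + q2 p.1 * q3 p.2 - q3 p.1 * q2 p.2,
   q0 p.1 * q2 p.2 - q1 p.1 * q3 p.2 + q2 p.1 * q0 p.2 + q3 p.1 * q1 p.2,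
   q0 p.1 * q3 p.2 + q1 p.1 * q2 p.2 - q2 p.1 * q1 p.2 + q3 p.1 * q0 p.2)).
  by apply/funext => s; exact: mulqE.
rewrite E; apply: quat_continuous.
- exact: (cvgB (cvgB (cvgB (cvgM l0 r0) (cvgM l1 r1)) (cvgM l2 r2)) (cvgM l3 r3)).
- exact: (cvgB (cvgD (cvgD (cvgM l0 r1) (cvgM l1 r0)) (cvgM l2 r3)) (cvgM l3 r2)).
- exact: (cvgD (cvgD (cvgB (cvgM l0 r2) (cvgM l1 r3)) (cvgM l2 r0)) (cvgM l3 r1)).
- exact: (cvgD (cvgB (cvgD (cvgM l0 r3) (cvgM l1 r2)) (cvgM l2 r1)) (cvgM l3 r0)).
Qed.

Definition qmul x y : quat R := x * y.

Lemma qmul_is_bilinear :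
  bilinear_for
    (GRing.Scale.Law.clone _ _ *:%R _) (GRing.Scale.Law.clone _ _ *:%R _) qmul.
Proof.
split=> [u'|u] a x y /=; rewrite /qmul.
- by rewrite mulrDl scalerAl.
- by rewrite mulrDr scalerAr.
Qed.

HB.instance Definition _ := bilinear_isBilinear.Build R (quat R) (quat R) (quat R)
  _ _ qmul qmul_is_bilinear.

(** For the sup norm the product of quaternions is not submultiplicative with
    constant 1; some constant exists because the product is bilinear and continuous. *)
Lemma mulq_bound : exists2 k : R, 0 < k & forall x y, `|x * y| <= k * `|x| * `|y|.
Proof.
exact: (@bilinear_schwarz R (quat R) (quat R) (quat R) qmul mulq_continuous).
Qed.

Lemma is_diff_mulq (V : normedModType R) (f g df dg : V -> quat R) (v : V) :
  is_diff v f df -> is_diff v g dg ->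
  is_diff v (fun w => f w * g w) (fun w => f v * dg w + df w * g v).
Proof.
move=> Df Dg.
have Dp : is_diff (f v, g v) (fun p : quat R * quat R => p.1 * p.2)
    (fun q => f v * q.2 + q.1 * g v).
  apply: DiffDef.
    exact: (@differentiable_bilin R (quat R) (quat R) (quat R) qmul _ mulq_continuous).
  exact: (@diff_bilin R (quat R) (quat R) (quat R) qmul (f v, g v) mulq_continuous).
have := is_diff_comp (is_diff_pair Df Dg) Dp.
exact.
Qed.

End quaternions.

(** * Imaginary units and polar coordinates *)

Section sphere.
Variable R : realType.
Implicit Types (x y J K : quat R) (a b : R).

(** Both conditions are the primal components of membership in sphere_dq; the dual
    components are the conditions of tangent. *)
Definition imag_unit J := J + conjq J = 0 /\ J * conjq J = 1.

Definition tangent J K := K + conjq K = 0 /\ J * conjq K + K * conjq J = 0.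

Definition imq x : quat R := (0, q1 x, q2 x, q3 x).

(** The scalar product of the imaginary parts. *)
Definition imdot x y : R := q1 x * q1 y + q2 x * q2 y + q3 x * q3 y.

Lemma eq_quat x y : q0 x = q0 y -> q1 x = q1 y -> q2 x = q2 y -> q3 x = q3 y -> x = y.
Proof. by move=> e0 e1 e2 e3; rewrite (quat_eta x) (quat_eta y) e0 e1 e2 e3. Qed.

Lemma conjqE x : conjq x = (q0 x, - q1 x, - q2 x, - q3 x).
Proof. by case: x => [[[]]]. Qed.

Lemma imag_q0 x : x + conjq x = 0 <-> q0 x = 0.
Proof.
rewrite conjqE; split.
  by move=> /(congr1 (@q0 R)); rewrite /q0 /= => H; lra.
by move=> x0; apply: eq_quat; rewrite /q0 /q1 /q2 /q3 /=; move: x0; rewrite /q0 => x0; lra.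
Qed.

Lemma mulq_conj J : J * conjq J = (q0 J ^+ 2 + imdot J J, 0, 0, 0).
Proof.
by rewrite conjqE mulqE; congr (_, _, _, _);
  rewrite /imdot /q0 /q1 /q2 /q3 /=; ring.
Qed.

Lemma imag_unitE J : imag_unit J <-> q0 J = 0 /\ imdot J J = 1.
Proof.
rewrite /imag_unit imag_q0 mulq_conj; split=> -[J0 J1]; split=> //.
  by case: J1; rewrite J0 expr0n /= add0r.
by rewrite J0 J1 expr0n /= add0r.
Qed.

Lemma tangentE J K : imag_unit J -> tangent J K -> q0 K = 0 /\ imdot J K = 0.
Proof.
move=> /imag_unitE[J0 _] [/imag_q0 K0 H]; split => //.
move: H => /(congr1 (@q0 R)); rewrite !conjqE !mulqE J0 K0 /imdot.
by rewrite /q0 /q1 /q2 /q3 /= => H; lra.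
Qed.

Lemma sphere_dqE (I : dquat R) :
  sphere_dq I <-> imag_unit I.1 /\ tangent I.1 I.2.
Proof.
case: I => I1 I2; split.
  move=> [E1 E2].
  have h1 := congr1 fst E1; have h2 := congr1 snd E1.
  by have h3 := congr1 fst E2; have h4 := congr1 snd E2.
move=> [[h1 h3] [h2 h4]]; split.
- exact: (congr2 pair h1 h2).
- exact: (congr2 pair h3 h4).
Qed.

Lemma sphere_dq_quat J : imag_unit J -> sphere_dq (dquat_of_quat J).
Proof.
move=> JJ; apply/sphere_dqE; split => //=; split.
  by apply/imag_q0.
have -> : conjq (0 : quat R) = 0 by rewrite conjqE; apply: eq_quat; rewrite /q0 /q1 /q2 /q3 /= ?oppr0.
by rewrite mulr0 mul0r addr0.
Qed.

Lemma coordE a b J : imag_unit J ->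
  [/\ q0 (a%:A + b *: J) = a, q1 (a%:A + b *: J) = b * q1 J,
  q2 (a%:A + b *: J) = b * q2 J & q3 (a%:A + b *: J) = b * q3 J].
Proof.
by move=> /imag_unitE[J0 _]; rewrite !qlinE J0 !mulr0 !mulr1 !addr0 !add0r.
Qed.

Lemma imq_linear : linear imq.
Proof.
by move=> k x y; apply: eq_quat; rewrite !qlinE // /q0 /= mulr0 addr0.
Qed.

Lemma imq_continuous : continuous imq.
Proof.
move=> x; apply: quat_continuous.
- exact: cvg_cst.
- exact: q1_continuous.
- exact: q2_continuous.
- exact: q3_continuous.
Qed.

Lemma quat_normE x :
  `|x| = Num.max (Num.max (Num.max `|q0 x| `|q1 x|) `|q2 x|) `|q3 x|.
Proof. by []. Qed.

Lemma coord_le_norm x :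
  [/\ `|q0 x| <= `|x|, `|q1 x| <= `|x|, `|q2 x| <= `|x| & `|q3 x| <= `|x|].
Proof. by rewrite quat_normE !le_max !lexx !orbT. Qed.

(** Polar coordinates of the imaginary part.  At real points the unit is chosen to
    be i: any choice works, since it is multiplied by 0.  The factor 2 bounds
    the ratio sqrt 3 of the Euclidean norm to the sup norm of the imaginary part. *)
Lemma imag_polar x : exists (N : R) J,
  [/\ imag_unit J, imq x = N *: J, `|N| <= 2 * `|x| & `|J| <= 1].
Proof.
have n0 : 0 <= imdot x x by rewrite /imdot -!expr2 !addr_ge0// sqr_ge0.
pose N := Num.sqrt (imdot x x); have NN : N ^+ 2 = imdot x x by rewrite sqr_sqrtr.
have N_le : `|N| <= 2 * `|x|.
  have [_ h1 h2 h3] := coord_le_norm x.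
  rewrite ger0_norm ?sqrtr_ge0// -[leRHS]ger0_norm ?mulr_ge0// -sqrtr_sqr ler_sqrt ?sqr_ge0//.
  have sq (c : R) : `|c| <= `|x| -> c * c <= `|x| ^+ 2.
    by move=> cx; rewrite -expr2 -real_normK ?num_real// lerXn2r ?nnegrE.
  have := sq _ h1; have := sq _ h2; have := sq _ h3; rewrite /imdot exprMn.
  have := sqr_ge0 `|x|; lra.
have unit_le J : imag_unit J -> `|J| <= 1.
  move=> /imag_unitE[J0]; rewrite /imdot => J1.
  have sq (c : R) : c * c <= 1 -> `|c| <= 1.
    by move=> c1; rewrite -(@expr_le1 _ 2)// real_normK ?num_real// expr2.
  have := sqr_ge0 (q1 J); have := sqr_ge0 (q2 J); have := sqr_ge0 (q3 J).
  rewrite !expr2 => p1 p2 p3.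
  by rewrite quat_normE !ge_max J0 normr0 ler01 !sq//; lra.
have [N0|N0] := eqVneq N 0.
  pose J : quat R := (0, 1, 0, 0).
  have JJ : imag_unit J by apply/imag_unitE; rewrite /imdot /J /q0 /q1 /q2 /q3 /=; split => //; ring.
  exists 0, J; split => //; [|by rewrite normr0 mulr_ge0|exact: unit_le].
  move: NN; rewrite N0 expr0n /= /imdot -!expr2 => /esym/eqP.
  rewrite !paddr_eq0 ?addr_ge0 ?sqr_ge0// !sqrf_eq0 => /andP[/andP[/eqP e1 /eqP e2] /eqP e3].
  by rewrite scale0r; apply: eq_quat; rewrite // /imq /q0 /q1 /q2 /q3 [LHS]/=.
have JJ : imag_unit (N^-1 *: imq x).
  apply/imag_unitE; rewrite /imdot !qlinE; split; first by rewrite mulr0.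
  rewrite -[q1 (imq x)]/(q1 x) -[q2 (imq x)]/(q2 x) -[q3 (imq x)]/(q3 x).
  transitivity (N^-1 * N^-1 * N ^+ 2); last by field.
  by rewrite NN /imdot; ring.
by exists N, (N^-1 *: imq x); split => //; [rewrite scalerA divff// scale1r|exact: unit_le].
Qed.

End sphere.

(** * The differential of the primal part of a slice function *)

Lemma addrr_inj (R : realType) (V : lmodType R) (p q : V) : p + p = q + q -> p = q.
Proof.
rewrite -[p + p]/(p *+ 2) -[q + q]/(q *+ 2) -(scaler_nat _ p) -(scaler_nat _ q) => /eqP.
by rewrite -subr_eq0 -scalerBr scaler_eq0 pnatr_eq0 /= subr_eq0 => /eqP.
Qed.

Lemma eq_oppr0 (R : realType) (V : lmodType R) (p : V) : p = - p -> p = 0.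
Proof. by move=> pN; apply: addrr_inj; rewrite {1}pN addNr addr0. Qed.

(** The identities of this form are proved for an arbitrary algebra, where the terms
    that stand for partial derivatives are opaque. *)
Lemma lin_comb_distr (R : realType) (A : algType R) (s t : R)
    (p0 r0 p1 r1 g J K : A) :
  (s *: p0 + t *: r0) + (J * (s *: p1 + t *: r1) + K * g) =
  s *: (p0 + J * p1) + t *: (r0 + J * r1) + K * g.
Proof.
by rewrite !scalerDr mulrDr -!scalerAr addrA [in RHS]addrACA.
Qed.

Lemma real_remainder (R : realType) (A : algType R) (s N : R)
    (g0 g0' a g1 b J : A) :
  (g0' + J * g1) - g0 - (s *: a + (N *: J) * b) =
  (g0' - g0 - s *: a) + J * (g1 - N *: b).
Proof.
rewrite mulrBr -scalerAl -scalerAr opprD !addrA; congr (_ - _).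
by rewrite -!addrA; congr (_ + _); rewrite addrCA; congr (_ + _); rewrite addrC.
Qed.

Lemma formula_rearrange (R : realType) (A : algType R) (s t : R)
    (h0 h1 a0 a1 b0 b1 g J K : A) :
  h0 + s *: a0 + t *: b0 + (J * (h1 + s *: a1 + t *: b1) + K * g) =
  h0 + J * h1 + (s *: (a0 + J * a1) + t *: (b0 + J * b1) + K * g).
Proof.
rewrite -lin_comb_distr -[h1 + _ + _]addrA mulrDr -!addrA; congr (_ + _).
by rewrite [RHS]addrCA; congr (_ + _); rewrite [RHS]addrCA.
Qed.

Lemma pair_no_increment (R : realType) (V : lmodType R) (p q x y : V) :
  (p, q) = (p, q + 0 *: x + 0 *: y).
Proof. by rewrite !scale0r !addr0. Qed.

Lemma is_diff_unit_comp (R : realType) (V W : normedModType R) (x : V)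
    (theta dtheta : V -> W) (u du : V -> quat R) (G0 G1 L0 L1 : W -> quat R) :
  is_diff x theta dtheta -> is_diff x u du ->
  is_diff (theta x) G0 L0 -> is_diff (theta x) G1 L1 ->
  is_diff x (fun y => G0 (theta y) + u y * G1 (theta y))
    (fun v => L0 (dtheta v) + (u x * L1 (dtheta v) + du v * G1 (theta x))).
Proof.
move=> dt dU d0 d1.
exact: (is_diffD (is_diff_comp dt d0) (is_diff_mulq dU (is_diff_comp dt d1))).
Qed.

Section primal.
Variables (R : realType) (D : set (R * R)).
Hypothesis Dopen : open D.
Variables (G0 G1 : R * R -> quat R) (F : quat R -> quat R).
Hypotheses (C0 : class_C 1 D G0) (C1 : class_C 1 D G1).
Hypothesis G0_even : forall z, D z -> G0 (conjc z) = G0 z.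
Hypothesis G1_odd : forall z, D z -> G1 (conjc z) = - G1 z.
Hypothesis FE : forall a b (J : quat R), D (a, b) -> imag_unit J ->
  F (a%:A + b *: J) = G0 (a, b) + J * G1 (a, b).

Let dG (G : R * R -> quat R) (z : R * R) : class_C 1 D G -> D z ->
  is_diff z G (fun w => w.1 *: partial_alpha G z + w.2 *: partial_beta G z).
Proof.
move=> CG Dz; have dG := C1_differentiable_quat Dopen CG Dz.
apply: DiffDef => //; apply/funext => -[s t] /=.
rewrite /partial_alpha /partial_beta !deriveE// -!linearZ -linearD.
by congr ('d G z _); congr (_, _);
  rewrite /= /GRing.scale /= !mulr1 !mulr0 ?addr0 ?add0r.
Qed.

Let imn (y : quat R) : R := imdot y y.

Let is_diff_imn (x : quat R) : is_diff x imn (fun v => 2 * imdot x v).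
Proof.
have d1 := @is_diff_linear R (quat R) R (@q1 R) x (@q1_linear R) (@q1_continuous R).
have d2 := @is_diff_linear R (quat R) R (@q2 R) x (@q2_linear R) (@q2_continuous R).
have d3 := @is_diff_linear R (quat R) R (@q3 R) x (@q3_linear R) (@q3_continuous R).
apply: (is_diff_eq (is_diffD (is_diffD (is_diffM d1 d1) (is_diffM d2 d2)) (is_diffM d3 d3))).
by apply/funext => v; rewrite /imdot !fctE /GRing.scale /=; ring.
Qed.

Section nonreal.
Variables (a b : R) (J : quat R).
Hypotheses (b_neq0 : b != 0) (Dab : D (a, b)) (JJ : imag_unit J).

Let x1 : quat R := a%:A + b *: J.
Let s (y : quat R) : R := Num.sg b * Num.sqrt (imn y).

Let s_sqr y : s y * s y = imn y.
Proof.
rewrite /s mulrACA -expr2 sqr_sg b_neq0 mul1r -expr2 sqr_sqrtr//.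
by rewrite /imn /imdot -!expr2 !addr_ge0// sqr_ge0.
Qed.

Let imn_x1 : imn x1 = b ^+ 2.
Proof.
have [_ e1 e2 e3] := coordE a b JJ; rewrite /imn /imdot /x1 e1 e2 e3.
have [_] := (imag_unitE J).1 JJ; rewrite /imdot => JJ1.
by rewrite -[RHS]mulr1 -JJ1; ring.
Qed.

Let s_x1 : s x1 = b.
Proof. by rewrite /s imn_x1 sqrtr_sqr -numEsg. Qed.

Let is_diff_s : is_diff x1 s (fun v => imdot J v).
Proof.
have n0 : 0 < imn x1 by rewrite imn_x1 exprn_even_gt0.
have := is_diffZ (Num.sg b) (is_diff_comp (is_diff_imn x1) (is_diff_sqrt n0)).
move/is_diff_eq; apply; apply/funext => v; rewrite !fctE /= /GRing.scale /=.
rewrite imn_x1 sqrtr_sqr.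
have [_ e1 e2 e3] := coordE a b JJ.
have -> : imdot x1 v = b * imdot J v by rewrite /imdot /x1 e1 e2 e3; ring.
have -> : b * imdot J v = Num.sg b * `|b| * imdot J v by rewrite -numEsg.
have sg2 : Num.sg b * Num.sg b = 1 by rewrite -expr2 sqr_sg b_neq0.
have nb : `|b| != 0 by rewrite normr_eq0.
transitivity ((Num.sg b * Num.sg b) * imdot J v); last by rewrite sg2 mul1r.
by field.
Qed.

Let theta (y : quat R) : R * R := (q0 y, s y).

Let theta_x1 : theta x1 = (a, b).
Proof. by have [e0 _ _ _] := coordE a b JJ; rewrite /theta s_x1 /x1 e0. Qed.

Let is_diff_theta : is_diff x1 theta (fun v => (q0 v, imdot J v)).
Proof.
have d0 := @is_diff_linear R (quat R) R (@q0 R) x1 (@q0_linear R) (@q0_continuous R).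
exact: is_diff_pair.
Qed.

Let imq_x1 : imq x1 = b *: J.
Proof.
have [_ e1 e2 e3] := coordE a b JJ.
have [J0 _] := (imag_unitE J).1 JJ.
apply: eq_quat; rewrite ?qlinE /imq /x1 ?e1 ?e2 ?e3 //.
by rewrite J0 mulr0.
Qed.

Let unit_part (y : quat R) : quat R := ((s y)^-1)%:A * imq y.

Let is_diff_unit_part : is_diff x1 unit_part
  (fun v => b^-1 *: imq v - (b^-1 * imdot J v) *: J).
Proof.
have b0 : s x1 != 0 by rewrite s_x1.
have d1 := is_diff_comp is_diff_s (is_diff_inv b0).
have lA : linear (fun r : R => r%:A : quat R).
  by move=> k r t; rewrite scalerDl scalerA.
have cA : continuous (fun r : R => r%:A : quat R) by exact: scalel_continuous.
have d2 := is_diff_comp d1 (is_diff_linear ((s x1)^-1) lA cA).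
have d3 := @is_diff_linear R (quat R) (quat R) (@imq R) x1 (@imq_linear R) (@imq_continuous R).
apply: (is_diff_eq (is_diff_mulq d2 d3)).
apply/funext => v; rewrite /= s_x1 !mulr_algl; congr (_ + _).
by rewrite imq_x1 scalerA -scaleNr; congr (_ *: _); field.
Qed.

Let F_near : {near x1, (fun y => G0 (theta y) + unit_part y * G1 (theta y)) =1 F}.
Proof.
(* s x1 = b is not 0, so near x1 the point is written in polar coordinates by s *)
have [ds _] := is_diff_s; have cs := differentiable_continuous ds.
have [dt _] := is_diff_theta; have ct := differentiable_continuous dt.
have nD : \forall y \near x1, D (theta y).
  have nt : nbhs (theta x1) D by rewrite theta_x1; apply: open_nbhs_nbhs.
  exact: (ct _ nt).
have ns : \forall y \near x1, s y != 0.
  have nt : nbhs (s x1) [set r : R | r != 0].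
    by apply: open_nbhs_nbhs; split; [exact: open_neq|rewrite /= s_x1].
  exact: (cs _ nt).
apply: filterS2 nD ns => y Dy sy.
have Jy : imag_unit (unit_part y).
  apply/imag_unitE; rewrite /unit_part mulr_algl /imdot !qlinE; split.
    by rewrite mulr0.
  rewrite -[q1 (imq y)]/(q1 y) -[q2 (imq y)]/(q2 y) -[q3 (imq y)]/(q3 y).
  transitivity ((s y)^-1 * (s y)^-1 * (s y * s y)); last by field.
  by rewrite s_sqr /imn /imdot; ring.
rewrite -FE//; congr F.
apply: eq_quat; rewrite !qlinE /unit_part mulr_algl !qlinE ?mulr0 ?mulr1 ?addr0 ?add0r//.
- by rewrite mulVKf.
- by rewrite mulVKf.
- by rewrite mulVKf.
Qed.

(** The chain rule for G0 (theta) + unit_part G1 (theta), an expression of F that is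
    valid near x1. *)
Lemma primal_diff_nonreal : is_diff x1 F (fun v =>
  q0 v *: (partial_alpha G0 (a, b) + J * partial_alpha G1 (a, b)) +
  imdot J v *: (partial_beta G0 (a, b) + J * partial_beta G1 (a, b)) +
  (b^-1 *: imq v - (b^-1 * imdot J v) *: J) * G1 (a, b)).
Proof.
apply: near_eq_is_diff F_near _.
have g0 : is_diff (theta x1) G0 (fun w => w.1 *: partial_alpha G0 (a, b) +
    w.2 *: partial_beta G0 (a, b)) by rewrite theta_x1; exact: dG.
have g1 : is_diff (theta x1) G1 (fun w => w.1 *: partial_alpha G1 (a, b) +
    w.2 *: partial_beta G1 (a, b)) by rewrite theta_x1; exact: dG.
have U : unit_part x1 = J by rewrite /unit_part s_x1 imq_x1 mulr_algl scalerK.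
apply: (is_diff_eq (is_diff_unit_comp is_diff_theta is_diff_unit_part g0 g1)).
apply/funext => v; rewrite theta_x1 U; exact: lin_comb_distr.
Qed.

End nonreal.

Lemma conjc_is_diff (z : R * R) : is_diff z (@conjc R) (@conjc R).
Proof.
apply: is_diff_linear.
  by move=> k [x y] [x' y']; congr (_, _); rewrite /= opprD scalerN.
move=> x; have c1 : {for x, continuous (fun x : R * R => x.1)} by exact: cvg_fst.
have c2 : {for x, continuous (fun x : R * R => x.2)} by exact: cvg_snd.
exact: (cvg_pair c1 (cvgN c2)).
Qed.

Section real.
Variable a : R.
Hypothesis Da : D (a, 0).

Let conj_a : conjc ((a, 0) : R * R) = (a, 0).
Proof. by rewrite /conjc oppr0. Qed.

Let diff_conj (G L : R * R -> quat R) : is_diff ((a, 0) : R * R) G L ->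
  is_diff ((a, 0) : R * R) (fun z => G (conjc z)) (fun w => L (conjc w)).
Proof.
move=> dGL; have := conjc_is_diff (a, 0) => dc.
have dGL' : is_diff (conjc ((a, 0) : R * R)) G L by rewrite conj_a.
exact: (is_diff_comp dc dGL').
Qed.

Lemma G1_real0 : G1 (a, 0) = 0.
Proof. by apply: eq_oppr0; rewrite -G1_odd// conj_a. Qed.

(** G0 (conjc z) = G0 z, differentiated at a fixed point of conjc. *)
Lemma partial_beta_even : partial_beta G0 (a, 0) = 0.
Proof.
have d0 := dG C0 Da; have dc := diff_conj d0.
have n : {near ((a, 0) : R * R), (fun z => G0 (conjc z)) =1 G0}.
  exact: (near_open Dopen (P := fun z => G0 (conjc z) = G0 z) Da G0_even).
have [_ e1] := near_eq_is_diff n dc; have [_ e2] := d0.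
have := congr1 (fun L : R * R -> quat R => L (0, 1)) (etrans (esym e2) e1).
rewrite /conjc; cbn [fst snd]; rewrite !scale0r !add0r scale1r scaleN1r.
exact: eq_oppr0.
Qed.

Lemma partial_alpha_odd : partial_alpha G1 (a, 0) = 0.
Proof.
have d0 := dG C1 Da; have dc := diff_conj d0.
have n : {near ((a, 0) : R * R), (fun z => G1 (conjc z)) =1 (fun z => - G1 z)}.
  exact: (near_open Dopen (P := fun z => G1 (conjc z) = - G1 z) Da G1_odd).
have [_ e1] := near_eq_is_diff n dc; have [_ e2] := is_diffN d0.
have := congr1 (fun L : R * R -> quat R => L (1, 0)) (etrans (esym e2) e1).
rewrite !fctE /conjc; cbn [fst snd]; rewrite oppr0 !scale0r !addr0 scale1r => E.
by apply: eq_oppr0; rewrite -[in LHS]E.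
Qed.

(** By parity the expansions of G0 and G1 at (a, 0) have no term in beta,
    respectively in 1 and alpha.  The unit J of the increment w depends on w in a
    discontinuous way, but it is bounded, so it does not spoil the remainder, and
    in the main term it occurs in N J = Im w only. *)
Lemma primal_diff_real : is_diff (a%:A : quat R) F (fun v =>
  q0 v *: partial_alpha G0 (a, 0) + imq v * partial_beta G1 (a, 0)).
Proof.
set A := partial_alpha G0 _; set B := partial_beta G1 _.
apply: is_diff_of_bound.
- move=> k x y; rewrite imq_linear mulrDl -scalerAl.
  by rewrite coordD coordZ !scalerDl !scalerDr scalerA addrACA.
- move=> x.
  have c1 : {for x, continuous (fun v => q0 v *: A)}.
    apply: (@continuous_comp _ _ _ (@q0 R) (fun r : R => r *: A)).
      exact: q0_continuous.
    exact: scalel_continuous.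
  have cB : {for x, continuous (fun v => (imq v, B))}.
    have cc : {for x, continuous (fun _ : quat R => B)} by exact: cvg_cst.
    exact: (cvg_pair (imq_continuous (x := x)) cc).
  have c2 : {for x, continuous (fun v => imq v * B)}.
    exact: (continuous_comp cB (@mulq_continuous R _)).
  exact: (cvgD c1 c2).
move=> e e0; have [k k0 kP] := mulq_bound R.
(* 2 bounds the norm of the increment (q0 w, N) in terms of that of w, 1 + k collects
   the remainder of G0 and that of G1 multiplied by a unit *)
pose e' := e / (2 * (1 + k)).
have e'0 : 0 < e' by rewrite divr_gt0// mulr_gt0// addr_gt0.
have b0 := is_diff_near_bound (dG C0 Da) e'0.
have b1 := is_diff_near_bound (dG C1 Da) e'0.
have nD : \forall p \near (0 : R * R), D ((a, 0) + p).
  have c : {for (0 : R * R), continuous (fun w => (a, 0) + w)}.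
    by apply: cvgD; [exact: cvg_cst|exact: cvg_id].
  have nt : nbhs ((a, 0) + (0 : R * R)) D by rewrite addr0; apply: open_nbhs_nbhs.
  exact: (c _ nt).
have [r r0 rP] := (nbhs_ballP _ _).1 (filterI nD (filterI b0 b1)).
apply/nbhs_ballP; exists (r / 2); first by rewrite /= divr_gt0.
move=> w; rewrite -ball_normE /= sub0r normrN => wr.
have [N [J [JJ wN Nw J1]]] := imag_polar w.
have p_le : `|((q0 w, N) : R * R)| <= 2 * `|w|.
  have [w0 _ _ _] := coord_le_norm w.
  rewrite prod_normE /= ge_max Nw andbT (le_trans w0)//.
  by rewrite mulr_natl mulr2n lerDl.
have pr : ball (0 : R * R) r (q0 w, N).
  by rewrite -ball_normE /= sub0r normrN (le_lt_trans p_le)// mulrC -ltr_pdivlMr.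
have [Dp [+ +]] := rP _ pr.
have zp : ((a, 0) : R * R) + (q0 w, N) = (a + q0 w, N).
  by congr (_, _); rewrite /= add0r.
move: Dp; rewrite zp => Dp; cbn [fst snd]; rewrite partial_beta_even partial_alpha_odd.
rewrite G1_real0 !scaler0 addr0 add0r subr0 -/A -/B => H0 H1.
have Fw : F (a%:A + w) = G0 (a + q0 w, N) + J * G1 (a + q0 w, N).
  rewrite -FE//; congr F; have [J0 _] := (imag_unitE J).1 JJ.
  apply: eq_quat; rewrite !qlinE ?J0 ?mulr0 ?mulr1 ?addr0 ?add0r//.
  - exact: (congr1 (@q1 R) wN).
  - exact: (congr1 (@q2 R) wN).
  - exact: (congr1 (@q3 R) wN).
have Fa : F a%:A = G0 (a, 0).
  have -> : a%:A = a%:A + 0 *: J by rewrite scale0r addr0.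
  by rewrite FE// G1_real0 mulr0 addr0.
have -> : F (a%:A + w) - F a%:A - (q0 w *: A + imq w * B) =
    (G0 (a + q0 w, N) - G0 (a, 0) - q0 w *: A) + J * (G1 (a + q0 w, N) - N *: B).
  by rewrite Fw Fa wN; exact: real_remainder.
apply: le_trans (ler_normD _ _) _.
have JG := kP J (G1 (a + q0 w, N) - N *: B).
have K2 : k * `|J| * `|G1 (a + q0 w, N) - N *: B| <= k * (e' * (2 * `|w|)).
  rewrite -mulrA ler_pM2l// -[leRHS]mul1r; apply: ler_pM => //.
  by apply: le_trans H1 _; rewrite ler_pM2l.
have K1 : `|G0 (a + q0 w, N) - G0 (a, 0) - q0 w *: A| <= e' * (2 * `|w|).
  by apply: le_trans H0 _; rewrite ler_pM2l.
have -> : e * `|w| = e' * (2 * `|w|) + k * (e' * (2 * `|w|)).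
  by rewrite /e'; field; rewrite gt_eqF// addr_gt0.
apply: lerD => //; exact: le_trans JG K2.
Qed.

End real.

(** The direction is written in the moving frame 1, J, K of the representation
    a + J b, which is how the natural extension describes it.  For b = 0 the
    direction K disappears from both sides, as G1 (a, 0) = 0. *)
Theorem primal_differential (a b s t : R) (J K : quat R) :
  D (a, b) -> imag_unit J -> tangent J K ->
  differentiable F (a%:A + b *: J) /\
  'd F (a%:A + b *: J) (s%:A + t *: J + b *: K) =
    s *: (partial_alpha G0 (a, b) + J * partial_alpha G1 (a, b)) +
    t *: (partial_beta G0 (a, b) + J * partial_beta G1 (a, b)) + K * G1 (a, b).
Proof.
move=> Dab JJ JK; have [J0 J1] := (imag_unitE J).1 JJ.
have [K0 JK0] := tangentE JJ JK.
set v := s%:A + _ + _.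
have v0 : q0 v = s by rewrite /v !qlinE J0 K0 !mulr0 !addr0 mulr1.
have vI : imq v = t *: J + b *: K.
  by apply: eq_quat; rewrite /imq /v !qlinE ?J0 ?K0 ?mulr0 ?addr0 ?add0r.
have [b0|b0] := eqVneq b 0.
  have -> : a%:A + b *: J = a%:A by rewrite b0 scale0r addr0.
  rewrite b0 scale0r addr0 in vI; rewrite b0 in Dab *.
  have [dF E] := primal_diff_real Dab; split => //; rewrite E v0 vI.
  rewrite partial_beta_even// partial_alpha_odd// G1_real0//.
  by rewrite !mulr0 !addr0 add0r scalerAl.
have vJ : imdot J v = t.
  transitivity (t * imdot J J + b * imdot J K); last by rewrite J1 JK0 mulr0 mulr1 addr0.
  by rewrite /imdot /v !qlinE; ring.
have [dF E] := primal_diff_nonreal b0 Dab JJ; split => //; rewrite E v0 vJ vI.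
congr (_ + _ * _).
by rewrite scalerDr !scalerA mulVf// scale1r addrAC subrr add0r.
Qed.

End primal.

(** * The natural extension *)

Section dual_quaternions.
Variable R : realType.
Implicit Types (x y I : dquat R) (D : set (R * R)).

Lemma dqM x y : ((x * y).1 = x.1 * y.1) * ((x * y).2 = x.1 * y.2 + x.2 * y.1).
Proof. by []. Qed.

Lemma dqD x y : ((x + y).1 = x.1 + y.1) * ((x + y).2 = x.2 + y.2).
Proof. by []. Qed.

Lemma dqZ (k : R) x : ((k *: x).1 = k *: x.1) * ((k *: x).2 = k *: x.2).
Proof. by []. Qed.

Lemma dq1 : ((1 : dquat R).1 = 1) * ((1 : dquat R).2 = 0).
Proof. by []. Qed.

Lemma dq_eps : ((eps R).1 = 0) * ((eps R).2 = 1).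
Proof. by []. Qed.

Lemma dq_quat (q : quat R) : ((dquat_of_quat q).1 = q) * ((dquat_of_quat q).2 = 0).
Proof. by []. Qed.

Definition dqE := (dqM, dqD, dqZ, dq1, dq_eps, dq_quat).

Lemma eq_dquat x y : x.1 = y.1 -> x.2 = y.2 -> x = y.
Proof. by case: x y => [a b] [c d] /= -> ->. Qed.

Lemma eps_quat (q : quat R) :
  ((eps R * dquat_of_quat q).1 = 0) * ((eps R * dquat_of_quat q).2 = q).
Proof. by split; rewrite !dqE ?mul0r// mul1r add0r. Qed.

Lemma dual_pointE (a b : R * R) I :
  ((dquat_of_dual a + I * dquat_of_dual b).1 = a.1%:A + b.1 *: I.1) *
  ((dquat_of_dual a + I * dquat_of_dual b).2 = a.2%:A + b.2 *: I.1 + b.1 *: I.2).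
Proof.
split; rewrite /dquat_of_dual !dqE !scaler0 !addr0 ?add0r !mulr_algr ?addrA//.
Qed.

Lemma check_stemE (Gl Hl : R * R -> quat R) (a b : R * R) :
  check_stem Gl Hl a b = (Gl (a.1, b.1),
    Hl (a.1, b.1) + a.2 *: partial_alpha Gl (a.1, b.1)
                  + b.2 *: partial_beta Gl (a.1, b.1)).
Proof. by apply: eq_dquat; rewrite /check_stem dqD eps_quat dq_quat ?addr0 ?add0r. Qed.

Lemma eps_stemE (p q : quat R) : dquat_of_quat p + eps R * dquat_of_quat q = (p, q).
Proof. by apply: eq_dquat; rewrite dqD eps_quat dq_quat ?addr0 ?add0r. Qed.

Lemma dual_point_real (al be : R) I :
  dquat_of_dual (al, 0) + I * dquat_of_dual (be, 0) = al%:A + be *: I.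
Proof.
by apply: eq_dquat; rewrite dual_pointE !dqE //= !scale0r scaler0 addr0 !add0r.
Qed.

Section natural_extension.
Variables (D : set (R * R)) (f fc : dquat R -> dquat R).

(** A point of Omega D has a representation with a2 = b2 = 0, where the correction
    terms of check_stem vanish. *)
Lemma natural_extension_Omega : natural_extension D f fc ->
  forall x, Omega D x -> f x = fc x.
Proof.
move=> [G [H [_ _ fE fcE]]] x [al [be [J [Dz JJ ->]]]].
rewrite -dual_point_real fcE// dual_point_real fE// !check_stemE.
cbn [fst snd stem_of_quat comp]; rewrite !eps_stemE.
by congr (_ + J * _); exact: pair_no_increment.
Qed.

(** At a quaternionic point the imaginary unit is quaternionic too, so the
    components of f are the slice functions of G and H. *)
Lemma induces_primal (G H : R * R -> quat R * quat R) :
  induces D (fun z => ((stem_of_quat G z).1 + eps R * (stem_of_quat H z).1,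
                       (stem_of_quat G z).2 + eps R * (stem_of_quat H z).2)) f ->
  forall (a b : R) (J : quat R), D (a, b) -> imag_unit J ->
  f (dquat_of_quat (a%:A + b *: J)) =
    ((G (a, b)).1 + J * (G (a, b)).2, (H (a, b)).1 + J * (H (a, b)).2).
Proof.
move=> fE a b J Dab JJ.
have -> : dquat_of_quat (a%:A + b *: J) = a%:A + b *: dquat_of_quat J.
  by apply: eq_dquat; rewrite !dqE ?scaler0 ?addr0.
rewrite fE//; last exact: sphere_dq_quat.
cbn [fst snd stem_of_quat]; rewrite !eps_stemE.
by apply: eq_dquat; rewrite dqD dqM dq_quat; cbn [fst snd]; rewrite ?mul0r ?addr0.
Qed.

Hypothesis Dopen : open D.

(** The primal components agree because x1 has the same representation; the dual
    components agree by primal_differential and a rearrangement. *)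
Theorem natural_extension_formula : natural_extension D f fc ->
  forall x1 x2 : quat R,
  check_Omega D (dquat_of_quat x1 + eps R * dquat_of_quat x2) ->
  differentiable (primal_part f) x1 /\
  fc (dquat_of_quat x1 + eps R * dquat_of_quat x2) =
    f (dquat_of_quat x1) + eps R * dquat_of_quat ('d (primal_part f) x1 x2).
Proof.
move=> [G [H [[sG CG] _ fE fcE]]] x1 x2 [a [b [I [Dab II xE]]]].
have [I1 I2] := (sphere_dqE I).1 II.
have e1 : x1 = a.1%:A + b.1 *: I.1.
  by have := congr1 fst xE; rewrite dual_pointE dqD eps_quat dq_quat addr0.
have e2 : x2 = a.2%:A + b.2 *: I.1 + b.1 *: I.2.
  by have := congr1 snd xE; rewrite dual_pointE dqD eps_quat dq_quat add0r.
rewrite xE fcE// e1 e2.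
have fst_lin : class_C 1 D (fst \o G).
  pose p1 : {linear (quat R * quat R)%type -> quat R} := fst.
  have c1 : continuous p1 by move=> x; exact: cvg_fst.
  exact: (class_C_linear Dopen c1 CG).
have snd_lin : class_C 1 D (snd \o G).
  pose p2 : {linear (quat R * quat R)%type -> quat R} := snd.
  have c2 : continuous p2 by move=> x; exact: cvg_snd.
  exact: (class_C_linear Dopen c2 CG).
have FE (s t : R) (J : quat R) : D (s, t) -> imag_unit J ->
    primal_part f (s%:A + t *: J) = (fst \o G) (s, t) + J * (snd \o G) (s, t).
  by move=> Dst JJ; rewrite /primal_part (induces_primal fE).
have ev z : D z -> (fst \o G) (conjc z) = (fst \o G) z.
  by move=> Dz; rewrite /= sG.
have od z : D z -> (snd \o G) (conjc z) = - (snd \o G) z.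
  by move=> Dz; rewrite /= sG.
have [dF ->] := primal_differential Dopen fst_lin snd_lin ev od FE a.2 b.2 Dab I1 I2.
split => //; rewrite (induces_primal fE)//.
rewrite !check_stemE.
apply: eq_dquat; rewrite !dqD dqM eps_quat; cbn [fst snd comp]; first by rewrite addr0.
exact: formula_rearrange.
Qed.

End natural_extension.
End dual_quaternions.

(** * Uniqueness and regularity of stem functions *)

Section stems.
Variables (R : realType) (D : set (R * R)).
Implicit Types (f g h : dquat R -> dquat R).

Lemma slice_DH_ext j k j' k' f f' : (j' <= j)%N -> (k' <= k)%N ->
  (forall x, Omega D x -> f x = f' x) -> slice_DH j k D f -> slice_DH j' k' D f'.
Proof.
move=> jj kk ff [f1 [f2 [[G [sG CG fG]] [H [sH CH fH]] fE]]].
exists f1, f2; split.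
- by exists G; split=> //; exact: class_C_le CG.
- by exists H; split=> //; exact: class_C_le CH.
- by move=> x Dx; rewrite -ff//; exact: fE.
Qed.

Lemma sphere_opp (J : dquat R) : sphere_dq J -> sphere_dq (- J).
Proof.
have cN : conjdq (- J) = - conjdq J.
  have cqN (q : quat R) : conjq (- q) = - conjq q.
    by rewrite (conjqE q) (conjqE (- q)).
  by apply: eq_dquat; exact: cqN.
by move=> [J1 J2]; split; rewrite cN; [rewrite -opprD J1 oppr0|rewrite mulrNN].
Qed.

Lemma sphere_sqr (J : dquat R) : sphere_dq J -> J * J = -1.
Proof.
move=> [/eqP]; rewrite addrC addr_eq0 => /eqP ->; rewrite mulrN => /eqP.
by rewrite eqr_oppLR => /eqP.
Qed.

Lemma sphere_nonempty : exists J : dquat R, sphere_dq J.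
Proof.
exists (dquat_of_quat (0, 1, 0, 0)); apply/sphere_dq_quat/imag_unitE.
by rewrite /imdot /q0 /q1 /q2 /q3 /=; split => //; ring.
Qed.

(** The sum of the two equations gives p, and J is invertible as J J = - 1. *)
Lemma stem_unique (p q p' q' J : dquat R) : sphere_dq J ->
  p + J * q = p' + J * q' -> p - J * q = p' - J * q' -> p = p' /\ q = q'.
Proof.
move=> JJ e1 e2.
have pp : p = p'.
  apply: addrr_inj.
  have -> : p + p = (p + J * q) + (p - J * q) by rewrite addrACA subrr addr0.
  by rewrite e1 e2 addrACA subrr addr0.
split => //; move: e1; rewrite pp => /addrI /(congr1 (fun x => J * x)).
by rewrite !mulrA sphere_sqr// !mulN1r => /oppr_inj.
Qed.

Lemma induces_unique (F F' : R * R -> dquat R * dquat R) f f' :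
  induces D F f -> induces D F' f' -> (forall x, Omega D x -> f x = f' x) ->
  forall z, D z -> F z = F' z.
Proof.
move=> Ff Ff' ff [a b] Dz; have [J JJ] := sphere_nonempty.
have val J' : sphere_dq J' ->
    (F (a, b)).1 + J' * (F (a, b)).2 = (F' (a, b)).1 + J' * (F' (a, b)).2.
  by move=> JJ'; rewrite -Ff// -Ff'//; apply: ff; exists a, b, J'.
have e1 := val _ JJ; have := val _ (sphere_opp JJ); rewrite !mulNr => e2.
have [E1 E2] := stem_unique JJ e1 e2.
by rewrite [LHS]surjective_pairing [RHS]surjective_pairing E1 E2.
Qed.

Lemma induces_sum (G H : R * R -> quat R * quat R) f g h :
  induces D (stem_of_quat G) g -> induces D (stem_of_quat H) h ->
  (forall x, Omega D x -> f x = g x + eps R * h x) ->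
  induces D (fun z => (((G z).1, (H z).1), ((G z).2, (H z).2))
               : dquat R * dquat R) f.
Proof.
move=> gE hE fE a b J Dz JJ.
rewrite fE; last by exists a, b, J.
rewrite gE// hE//; cbn [fst snd stem_of_quat].
have epsM (x : dquat R) : ((eps R * x).1 = 0) * ((eps R * x).2 = x.1).
  by split; rewrite dqM !dq_eps mul0r// mul1r add0r.
apply: eq_dquat; rewrite !dqD epsM !dqM ?dqD ?dqM !dq_quat; cbn [fst snd].
  by rewrite addr0.
by rewrite mulr0 !add0r addrC -addrA.
Qed.

Hypothesis Dopen : open D.

(** The equation of slice regularity, read on the components of 1 and e1, is the
    Cauchy-Riemann system for the two components of the stem. *)
Lemma regular_stem_class_C k (F : R * R -> dquat R * dquat R) :
  class_C 1 D F ->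
  (forall z, D z -> partial_alpha F z + mul_e1 (partial_beta F z) = 0) ->
  class_C k D (fst \o F) /\ class_C k D (snd \o F).
Proof.
move=> CF FCR.
pose p1 : {linear (dquat R * dquat R)%type -> dquat R} := fst.
pose p2 : {linear (dquat R * dquat R)%type -> dquat R} := snd.
have c1 : continuous p1 by move=> x; exact: cvg_fst.
have c2 : continuous p2 by move=> x; exact: cvg_snd.
have Cu : class_C 1 D (fst \o F) := class_C_linear Dopen c1 CF.
have Cv : class_C 1 D (snd \o F) := class_C_linear Dopen c2 CF.
have uv : cauchy_riemann D (fst \o F) (snd \o F).
  move=> z Dz; have [_ [dF _ _]] := CF; have [da db] := dF z Dz.
  have [_ ua] := is_derive_linear c1 (derivableP da).
  have [_ ub] := is_derive_linear c1 (derivableP db).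
  have [_ va] := is_derive_linear c2 (derivableP da).
  have [_ vb] := is_derive_linear c2 (derivableP db).
  have E := FCR z Dz; have E1 := congr1 fst E; have E2 := congr1 snd E.
  split.
    apply: etrans ua _; apply: etrans _ (esym vb).
    by apply/eqP; rewrite -subr_eq0; apply/eqP; exact: E1.
  apply: etrans ub _; apply: etrans _ (esym (congr1 -%R va)).
  by apply/eqP; rewrite -addr_eq0 addrC; apply/eqP; exact: E2.
have hD := holomorphic_smooth_dquat Dopen.
split; first exact: (hD k _ _ Cu Cv uv).
exact: (hD k _ _ Cv (class_CN Dopen Cu) (cauchy_riemann_rot Cu uv)).
Qed.

Lemma class_C_components k (G H : R * R -> quat R * quat R)
    (F : R * R -> dquat R * dquat R) :
  (forall z, D z -> F z = (((G z).1, (H z).1), ((G z).2, (H z).2))) ->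
  class_C k D (fst \o F) -> class_C k D (snd \o F) ->
  class_C k D G /\ class_C k D H.
Proof.
move=> FE Cu Cv.
pose p1 : {linear (quat R * quat R)%type -> quat R} := fst.
pose p2 : {linear (quat R * quat R)%type -> quat R} := snd.
have c1 : continuous p1 by move=> x; exact: cvg_fst.
have c2 : continuous p2 by move=> x; exact: cvg_snd.
have u1 := class_C_linear Dopen c1 Cu; have u2 := class_C_linear Dopen c2 Cu.
have v1 := class_C_linear Dopen c1 Cv; have v2 := class_C_linear Dopen c2 Cv.
split.
- apply: class_C_ext (class_C_pair Dopen u1 v1) => // z Dz.
  by rewrite /= FE//= -surjective_pairing.
- apply: class_C_ext (class_C_pair Dopen u2 v2) => // z Dz.
  by rewrite /= FE//= -surjective_pairing.
Qed.

End stems.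

Theorem theorem7p2 (R : realType) (D : set (R * R))
    (f g h fc : dquat R -> dquat R)
    (hDopen : open D) (hDconj : conj_invariant D)
    (hg : slice_H 1 D g) (hh : slice_H 0 D h)
    (hf : forall x, Omega D x -> f x = g x + eps R * h x)
    (hfc : natural_extension D f fc) :
  [/\ (forall x1 x2 : quat R,
         check_Omega D (dquat_of_quat x1 + eps R * dquat_of_quat x2) ->
         ~ real_quat x1 ->
         differentiable (primal_part f) x1 /\
         fc (dquat_of_quat x1 + eps R * dquat_of_quat x2) =
           f (dquat_of_quat x1) +
           eps R * dquat_of_quat ('d (primal_part f) x1 x2)),
      (slice_DH 3 0 D f ->
       forall x1 x2 : quat R,
         check_Omega D (dquat_of_quat x1 + eps R * dquat_of_quat x2) ->
         differentiable (primal_part f) x1 /\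
         fc (dquat_of_quat x1 + eps R * dquat_of_quat x2) =
           f (dquat_of_quat x1) +
           eps R * dquat_of_quat ('d (primal_part f) x1 x2)),
      (DSk 2 D fc -> slice_DH 3 0 D f) &
      (DSR D fc -> DSk 2 D fc /\ slice_DH 3 0 D f)].
Proof.
have formula := natural_extension_formula hDopen hfc.
have DS2 : DSk 2 D fc -> slice_DH 3 0 D f.
  move=> [f' Sf' f'c]; apply: slice_DH_ext Sf' => // x Dx.
  by rewrite (natural_extension_Omega f'c)// (natural_extension_Omega hfc).
split => //; first by move=> x1 x2 Dx _; exact: formula.
move=> [f' [F [_ CF FCR f'E]] f'c].
suff D2 : DSk 2 D fc by split => //; exact: DS2.
exists f => //.
have [Gg [sG _ gE]] := hg; have [Hh [sH _ hE]] := hh.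
have ff x : Omega D x -> f' x = f x.
  by move=> Dx; rewrite (natural_extension_Omega f'c)// (natural_extension_Omega hfc).
have FE := induces_unique f'E (induces_sum gE hE hf) ff.
have smooth k := class_C_components hDopen FE (regular_stem_class_C hDopen k CF FCR).1
  (regular_stem_class_C hDopen k CF FCR).2.
exists g, h; split => //.
- by exists Gg; split; [exact: sG|exact: (smooth 3%N).1|exact: gE].
- by exists Hh; split; [exact: sH|exact: (smooth 2%N).2|exact: hE].
Qed.
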